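(* Let $\hat{\mathcal O}\subset\mathbb R^n$ be a bounded, connected Lipschitz domain, let $F\hat x=x_0+B\hat x$ with $x_0\in\mathbb R^n$ and $B\in\mathbb R^{n\times n}$ invertible, and let $\mathcal O=F(\hat{\mathcal O})$. Let $k(s,\hat{\mathcal O})$, $K(s,\hat{\mathcal O})$, $C_{\rm PF,I}(s,\hat{\mathcal O})$ and $C_{\rm PF,SS}(s,\hat{\mathcal O})$ be the constants on $\hat{\mathcal O}$ described in the context. Then for every $s\in(0,1)$ and every $v\in H^s(\mathcal O)$: (i) $$|v|_{s,\mathcal O}^2\le |\det B|\,\|B^{-1}\|^{n+2s}\,\|B\|^{2s}\,K(s,\hat{\mathcal O})^2\Bigl(3+\frac{C_{\rm PF,I}(s,\hat{\mathcal O})^2}{s(1-s)}\Bigr)\,|v|_{L^2(\mathcal O),H^1(\mathcal O),s}^2;$$ (ii) $$|v|_{L^2(\mathcal O),H^1(\mathcal O),s}^2\le |\det B|^{-1}\,\|B\|^{n+2s}\,\|B^{-1}\|^{2s}\,k(s,\hat{\mathcal O})^{-2}\Bigl(1+C_{\rm PF,SS}(s,\hat{\mathcal O})^2\Bigr)\,|v|_{s,\mathcal O}^2.$$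
   Context: Functions are real valued. For a bounded connected Lipschitz domain $\mathcal O\subset\mathbb R^n$, $\|\cdot\|_{0,\mathcal O}$ is the $L^2(\mathcal O)$-norm, $|v|_{1,\mathcal O}=\|\nabla v\|_{0,\mathcal O}$, and $\|v\|_{1,\mathcal O}^2=\|v\|_{0,\mathcal O}^2+|v|_{1,\mathcal O}^2$. For $0<s<1$: - Sobolev-Slobodeckij semi-norm: $|v|_{s,\mathcal O}=\Bigl(\int_{\mathcal O}\int_{\mathcal O}\frac{|v(x)-v(y)|^2}{|x-y|^{n+2s}}\,dx\,dy\Bigr)^{1/2}$; Sobolev-Slobodeckij norm: $\|v\|_{s,\mathcal O}=\bigl(\|v\|_{0,\mathcal O}^2+|v|_{s,\mathcal O}^2\bigr)^{1/2}$. $H^s(\mathcal O)$ is the space of $v\in L^2(\mathcal O)$ with $\|v\|_{s,\mathcal O}<\infty$. - Interpolation norm: $\|v\|_{L^2(\mathcal O),H^1(\mathcal O),s}=\Bigl(\int_0^\infty t^{-2s}\inf_{v=v_0+v_1}\bigl(\|v_0\|_{0,\mathcal O}^2+t^2\|v_1\|_{1,\mathcal O}^2\bigr)\frac{dt}{t}\Bigr)^{1/2}$. - Interpolation semi-norm: $|v|_{L^2(\mathcal O),H^1(\mathcal O),s}=\Bigl(\int_0^\infty t^{-2s}\inf_{v=v_0+v_1}\bigl(\|v_0\|_{0,\mathcal O}^2+t^2|v_1|_{1,\mathcal O}^2\bigr)\frac{dt}{t}\Bigr)^{1/2}$. The infima are over $v_0\in L^2(\mathcal O)$, $v_1\in H^1(\mathcal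 O)$ with $v_0+v_1=v$. For matrices, $\|\cdot\|$ is the operator norm induced by the Euclidean norm. Constants on a bounded connected Lipschitz domain $\mathcal O$, for given $s\in(0,1)$: - $k(s,\mathcal O),K(s,\mathcal O)>0$ are constants (which exist) such that $k(s,\mathcal O)\|w\|_{L^2(\mathcal O),H^1(\mathcal O),s}\le\|w\|_{s,\mathcal O}\le K(s,\mathcal O)\|w\|_{L^2(\mathcal O),H^1(\mathcal O),s}$ for all $w\in H^s(\mathcal O)$. - $C_{\rm PF,I}(s,\mathcal O)>0$ is a constant (which exists) such that $\|w\|_{0,\mathcal O}\le C_{\rm PF,I}(s,\mathcal O)\bigl(|w|_{L^2(\mathcal O),H^1(\mathcal O),s}+|\int_{\mathcal O}w|\bigr)$ for all $w\in H^s(\mathcal O)$. - $C_{\rm PF,SS}(s,\mathcal O)=|\mathcal O|^{-1/2}\max\{1,2^{-1/2}D_{\mathcal O}^{n/2+s}\}$, where $|\mathcal O|$ is the Lebesgue measure and $D_{\mathcal O}$ the diameter of $\mathcal O$. With it, $\|w\|_{0,\mathcal O}\le C_{\rm PF,SS}(s,\mathcal O)\bigl(|w|_{s,\mathcal O}+|\int_{\mathcal O}w|\bigr)$ for all $w\in H^s(\mathcal O)$. *)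

(* Defs.v *)
From HB Require Import structures.
From mathcomp Require Import all_boot all_order all_algebra.
From mathcomp Require Import all_classical all_reals all_analysis.
From mathcomp Require Import lra.
Import Order.TTheory GRing.Theory Num.Theory.
Import numFieldNormedType.Exports.

Set Implicit Arguments.
Unset Strict Implicit.
Unset Printing Implicit Defensive.

Local Open Scope classical_set_scope.
Local Open Scope ring_scope.

(* R^n is 'cV[R]_n, so that the matrix B acts by B *m x. The norm that the
   library puts on 'cV[R]_n is the sup norm: it is only used for topological
   notions (open, bounded, differentiable, ...). *)

Definition enorm {R : realType} {n : nat} (x : 'cV[R]_n) : R :=
  Num.sqrt (\sum_i x i 0 ^+ 2).

Definition opnorm {R : realType} {n : nat} (B : 'M[R]_n) : R :=
  sup [set enorm (B *m x) | x in [set x : 'cV[R]_n | enorm x <= 1]].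

Definition diameter {R : realType} {n : nat} (O : set 'cV[R]_n) : R :=
  sup [set r | exists x y, [/\ O x, O y & r = enorm (x - y)]].

(* The sigma-algebra generated by the coordinates, as the library does for
   n.-tuple; it is the Borel sigma-algebra of R^n (see open_measurable_cV). *)
Section measurable_cV.
Context {R : realType} (n : nat).

Let coord (i : 'I_n) (x : 'cV[R]_n) : measurableTypeR R := x i 0.

Let cV_set0 : g_sigma_preimage coord set0.
Proof. exact: sigma_algebra0. Qed.

Let cV_setC A : g_sigma_preimage coord A -> g_sigma_preimage coord (~` A).
Proof. exact: sigma_algebraC. Qed.

Let cV_bigcup (F : (set 'cV[R]_n)^nat) :
  (forall i, g_sigma_preimage coord (F i)) ->
  g_sigma_preimage coord (\bigcup_i (F i)).
Proof. exact: sigma_algebra_bigcup. Qed.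

HB.instance Definition _ := @isMeasurable.Build
  (measure_tuple_display default_measure_display)
  'cV[R]_n (g_sigma_preimage coord) cV_set0 cV_setC cV_bigcup.

End measurable_cV.

Lemma measurable_coord {R : realType} n (i : 'I_n) :
  measurable_fun setT (fun x : 'cV[R]_n => x i 0 : measurableTypeR R).
Proof.
move=> _ Y mY; rewrite setTI; apply: sub_sigma_algebra => /=.
rewrite -bigcup_seq/=; exists i => /=; first by rewrite mem_index_enum.
by exists Y => //; rewrite setTI.
Qed.

Lemma measurable_fun_cVP {R : realType} d (T : measurableType d) n
    (f : T -> 'cV[R]_n) :
  measurable_fun setT f <->
  forall i, measurable_fun setT (fun t => f t i 0 : measurableTypeR R).
Proof.
split=> [mf i|mf].
  exact: (measurableT_comp (measurable_coord i) mf).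
move=> _ A mA; rewrite setTI.
have: (preimage_set_system setT f measurable : set (set T)) `<=` measurable ->
  measurable (f @^-1` A).
  by apply; exists A => //; rewrite setTI.
apply.
have -> : (preimage_set_system setT f measurable : set (set T)) =
   g_sigma_preimage (fun i => (fun x : 'cV[R]_n => x i 0 : measurableTypeR R) \o f).
  by rewrite g_sigma_preimage_comp.
apply: smallest_sub; first exact: sigma_algebra_measurable.
case: n f mf A mA => [|n] f mf A mA; first by rewrite big_ord0.
rewrite -bigcup_mkord_ord; apply: bigcup_sub => i Ii.
by move=> _ [B mB <-]; exact: mf.
Qed.

Lemma open_measurable_cV {R : realType} n (A : set 'cV[R]_n) :
  open A -> measurable A.
Proof.
move=> oA.
pose box (p : {ffun 'I_n -> rat} * rat) : set 'cV[R]_n :=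
  [set y | forall i, `|ratr (p.1 i) - y i 0| < ratr p.2].
have mbox p : measurable (box p).
  rewrite (_ : box p = \bigcap_(i in [set: 'I_n])
      (fun x : 'cV[R]_n => x i 0 : measurableTypeR R) @^-1`
        ball (ratr (p.1 i) : R) (ratr p.2)); last first.
    by apply/seteqP; split => [y yp i _|y yp i]; [exact: yp|exact: (yp i)].
  apply: fin_bigcap_measurable => // i _.
  rewrite -[X in measurable X]setTI; apply: measurable_coord => //.
  exact: measurable_realfun.measurable_ball.
have -> : A = \bigcup_p (if pselect (box p `<=` A) then box p else set0).
  apply/seteqP; split => [x Ax|x [p _]]; last by case: pselect => // pA /pA.
  have /nbhs_ballP[e /= e0 eA] : nbhs x A by exact: open_nbhs_nbhs.
  have [r /andP[r0 re]] : exists r : rat, 0 < (ratr r : R) < e / 2.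
    have /rat_in_itvoo[r] : (0 : R) < e / 2 by rewrite divr_gt0.
    by rewrite in_itv/= => ?; exists r.
  have q_ i : exists q : rat, `|ratr q - x i 0| < ratr r.
    have /rat_in_itvoo[q] : x i 0 - ratr r < x i 0 + ratr r.
      by rewrite ltrD2l gtrN.
    by rewrite in_itv/= -ltr_distl => ?; exists q.
  pose q := [ffun i => projT1 (cid (q_ i))].
  have qx : box (q, r) x by move=> i; rewrite ffunE; case: cid.
  have qA : box (q, r) `<=` A.
    move=> y qy; apply: eA; split=> // i j; rewrite (ord1 j) /ball/=.
    rewrite (le_lt_trans (ler_distD (ratr (q i)) _ _))// distrC.
    by have := qx i; have := qy i; rewrite /=; lra.
  by exists (q, r) => //; case: pselect.
apply: countable_bigcupT_measurable => [|p]; first exact: countableP.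
by case: pselect => ?; [exact: mbox|exact: measurable0].
Qed.

Definition cV_cons {R : realType} {n : nat} (p : R * 'cV[R]_n) : 'cV[R]_n.+1 :=
  col_mx p.1%:M p.2.

(* The n-fold product of the Lebesgue measure of R, on Borel sets. *)
Fixpoint lebesgue_cV {R : realType} {n : nat} : set 'cV[R]_n -> \bar R :=
  match n with
  | 0 => \d_(0 : 'cV[R]_0)
  | _.+1 => pushforward (lebesgue_measure \x lebesgue_cV)%E cV_cons
  end.

Lemma measurable_cV_cons {R : realType} n :
  measurable_fun setT (@cV_cons R n : measurableTypeR R * 'cV[R]_n -> _).
Proof.
apply/measurable_fun_cVP => i; rewrite /cV_cons.
have [j ->|j ->] := split_ordP (i : 'I_(1 + n)).
  under eq_fun do rewrite (@col_mxEu _ 1 n) (ord1 j) mxE mulr1n.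
  exact: measurable_fst.
under eq_fun do rewrite (@col_mxEd _ 1 n).
exact: (measurableT_comp (measurable_coord j) measurable_snd).
Qed.

Lemma measurable_cV_uncons {R : realType} n :
  measurable_fun setT (fun x : 'cV[R]_n.+1 =>
    (x 0 0, dsubmx (x : 'cV_(1 + n))) : measurableTypeR R * 'cV[R]_n).
Proof.
apply/measurable_fun_pairP; split; first exact: measurable_coord.
apply/measurable_fun_cVP => i /=.
under eq_fun do rewrite mxE.
exact: measurable_coord.
Qed.


Section pack_sigma_finite.
Context d (T : measurableType d) (R : realType) (m : {measure set T -> \bar R}).

Definition sigma_finite_pack (_ : sigma_finite setT m) : set T -> \bar R := m.

Hypothesis mfin : sigma_finite setT m.

HB.instance Definition _ := Measure.copy (sigma_finite_pack mfin) m.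
HB.instance Definition _ := Measure_isSigmaFinite.Build _ _ _ (sigma_finite_pack mfin) mfin.

Lemma pack_sigma_finite :
  exists m' : {sigma_finite_measure set T -> \bar R}, m = m' :> (set T -> \bar R).
Proof. by exists (sigma_finite_pack mfin). Qed.

End pack_sigma_finite.

Lemma lebesgue_cV_sigma_finite {R : realType} n :
  exists m : {sigma_finite_measure set 'cV[R]_n -> \bar R},
    lebesgue_cV = m :> (set 'cV[R]_n -> \bar R).
Proof.
elim: n => [|n [m mE]]; first by exists \d_(0 : 'cV[R]_0).
pose prod : {measure set _ -> \bar R} := (@lebesgue_measure R \x m)%E.
have prod_sf : exists2 F : (set (measurableTypeR R * 'cV[R]_n)%type)^nat, setT = \bigcup_k F k &
    forall k, measurable (F k) /\ (prod (F k) < +oo)%E.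
  have /sigma_finiteP[F [TF ndF Foo]] := sigma_finiteT (@lebesgue_measure R).
  have /sigma_finiteP[G [TG ndG Goo]] := sigma_finiteT m.
  exists (fun k => F k `*` G k).
    rewrite -setXTT TF TG predeqE => -[x y]; split.
      move=> [/= [i _ Fix] [k _ Gky]]; exists (maxn i k) => //; split.
      - by move: x Fix; exact/subsetPset/ndF/leq_maxl.
      - by move: y Gky; exact/subsetPset/ndG/leq_maxr.
    by move=> [i _ []/= ? ?]; split; exists i.
  move=> k; have [mFk Fk] := Foo k; have [mGk Gk] := Goo k.
  split; first exact: measurableX.
  by rewrite /prod/= product_measure1E// lte_mul_pinfty// ge0_fin_numE.
pose mu := pushforward prod (@cV_cons R n : _ -> 'cV[R]_n.+1).
have -> : lebesgue_cV = mu :> (set 'cV[R]_n.+1 -> \bar R) by rewrite /= mE.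
have mu_fin : sigma_finite setT mu.
  have [F FT Ff] := prod_sf.
  exists (fun k => (fun x : 'cV[R]_n.+1 =>
      (x 0 0, dsubmx (x : 'cV_(1 + n))) : measurableTypeR R * 'cV[R]_n) @^-1` F k).
    by rewrite -preimage_bigcup -FT preimage_setT.
  move=> k; have [mFk Fk] := Ff k; split.
    by have := @measurable_cV_uncons R n measurableT _ mFk; rewrite setTI.
  rewrite /mu /pushforward -comp_preimage (_ : _ \o _ = id) ?preimage_id//.
  apply/funext => -[a b] /=; rewrite /cV_cons col_mxKd; congr (_, _).
  have -> : (0 : 'I_n.+1) = lshift n (0 : 'I_1) by exact/val_inj.
  by rewrite (@col_mxEu _ 1 n) mxE.
pose mu' : {measure set 'cV[R]_n.+1 -> \bar R} := HB.pack mu.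
exact: (@pack_sigma_finite _ _ _ (mu' (@measurable_cV_cons R n)) mu_fin).
Qed.

Section lebesgue_cV_measure.
Context {R : realType} {n : nat}.
Local Notation mu := (@lebesgue_cV R n).

Let mu0 : mu set0 = 0%E.
Proof. by have [m ->] := @lebesgue_cV_sigma_finite R n. Qed.

Let mu_ge0 A : (0 <= mu A)%E.
Proof. by have [m ->] := @lebesgue_cV_sigma_finite R n. Qed.

Let mu_sigma : semi_sigma_additive mu.
Proof.
have [m ->] := @lebesgue_cV_sigma_finite R n; exact: measure_semi_sigma_additive.
Qed.

HB.instance Definition _ := isMeasure.Build _ _ _ mu mu0 mu_ge0 mu_sigma.

Let mu_fin : sigma_finite setT mu.
Proof.
have [m ->] := @lebesgue_cV_sigma_finite R n; exact: sigma_finiteT.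
Qed.

HB.instance Definition _ := Measure_isSigmaFinite.Build _ _ _ mu mu_fin.

End lebesgue_cV_measure.

(* An open set with Lipschitz boundary: near each boundary point p and after a
   rotation Q, it is the strict epigraph, in the direction of the coordinate i,
   of a Lipschitz function phi of the n - 1 other coordinates. *)
Definition bounded_lipschitz_domain {R : realType} {n : nat}
    (O : set 'cV[R]_n) : Prop :=
  [/\ O !=set0, open O, connected O, bounded_set O &
    forall p, (closure O `\` O) p ->
    exists (i : 'I_n) (Q : 'M[R]_n) (r : R) (phi : 'cV[R]_n.-1 -> R),
      [/\ Q^T *m Q = 1%:M, 0 < r, lipschitz phi &
        forall x, enorm (x - p) < r ->
          (O x <-> phi (row' i (Q *m x)) < (Q *m x) i 0)]].

(* Elements of L^2(O), H^1(O) and H^s(O) are represented by functions on R^n,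
   of which only the restriction to O matters. Every class of functions modulo
   equality almost everywhere has a Borel representative. *)

Definition L2norm {R : realType} {n : nat} (O : set 'cV[R]_n)
    (v : 'cV[R]_n -> R) : \bar R :=
  sqrte (\int[lebesgue_cV]_(x in O) (`|v x| ^+ 2)%:E)%E.

Definition isL2 {R : realType} {n : nat} (O : set 'cV[R]_n)
    (v : 'cV[R]_n -> R) : Prop :=
  measurable_fun O v /\ (L2norm O v < +oo)%E.

Definition partial {R : realType} {n : nat} (i : 'I_n) (f : 'cV[R]_n -> R) :
    'cV[R]_n -> R :=
  fun x => 'D_(delta_mx i 0) f x.

Definition smooth {R : realType} {n : nat} (f : 'cV[R]_n -> R) : Prop :=
  forall (l : seq 'I_n) (x : 'cV[R]_n), differentiable (foldr partial f l) x.

Definition test_fun {R : realType} {n : nat} (O : set 'cV[R]_n)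
    (phi : 'cV[R]_n -> R) : Prop :=
  let supp := closure [set x | phi x != 0] in
  [/\ smooth phi, compact supp & supp `<=` O].

(* v belongs to H^1(O), with weak gradient g. Weak gradients are unique almost
   everywhere on O, so that L2norm O (enorm \o g) does not depend on the choice
   of g: it is |v|_{1,O}. *)
Definition isH1 {R : realType} {n : nat} (O : set 'cV[R]_n)
    (v : 'cV[R]_n -> R) (g : 'cV[R]_n -> 'cV[R]_n) : Prop :=
  [/\ isL2 O v, forall i, isL2 O (fun x => g x i 0) &
    forall (i : 'I_n) (phi : 'cV[R]_n -> R), test_fun O phi ->
      \int[lebesgue_cV]_(x in O) (v x * partial i phi x) =
      - \int[lebesgue_cV]_(x in O) (g x i 0 * phi x)].

Definition H1seminorm {R : realType} {n : nat} (O : set 'cV[R]_n)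
    (g : 'cV[R]_n -> 'cV[R]_n) : \bar R :=
  L2norm O (fun x => enorm (g x)).

Definition H1norm {R : realType} {n : nat} (O : set 'cV[R]_n)
    (v : 'cV[R]_n -> R) (g : 'cV[R]_n -> 'cV[R]_n) : \bar R :=
  sqrte (L2norm O v ^+ 2 + H1seminorm O g ^+ 2)%E.

(* On the diagonal x = y the integrand is 0 / 0 = 0. *)
Definition SSseminorm {R : realType} {n : nat} (s : R) (O : set 'cV[R]_n)
    (v : 'cV[R]_n -> R) : \bar R :=
  sqrte (\int[lebesgue_cV]_(y in O) \int[lebesgue_cV]_(x in O)
    (`|v x - v y| ^+ 2 / enorm (x - y) `^ (n%:R + 2 * s))%:E)%E.

Definition SSnorm {R : realType} {n : nat} (s : R) (O : set 'cV[R]_n)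
    (v : 'cV[R]_n -> R) : \bar R :=
  sqrte (L2norm O v ^+ 2 + SSseminorm s O v ^+ 2)%E.

Definition isHs {R : realType} {n : nat} (s : R) (O : set 'cV[R]_n)
    (v : 'cV[R]_n -> R) : Prop :=
  isL2 O v /\ (SSnorm s O v < +oo)%E.

(* (\int_0^oo t^(-2s) K(t) dt/t)^(1/2) *)
Definition interp_of_K {R : realType} (s : R) (K : R -> \bar R) : \bar R :=
  sqrte (\int[lebesgue_measure]_(t in `]0%R, +oo[)
    ((t `^ (- (2 * s)))%:E * K t * (t^-1)%:E))%E.

Definition interp_norm {R : realType} {n : nat} (s : R) (O : set 'cV[R]_n)
    (v : 'cV[R]_n -> R) : \bar R :=
  interp_of_K s (fun t => ereal_inf [set y | exists v0 v1 g,
    [/\ isL2 O v0, isH1 O v1 g, forall x, O x -> v x = v0 x + v1 x &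
      y = (L2norm O v0 ^+ 2 + (t ^+ 2)%:E * H1norm O v1 g ^+ 2)%E]]).

Definition interp_seminorm {R : realType} {n : nat} (s : R) (O : set 'cV[R]_n)
    (v : 'cV[R]_n -> R) : \bar R :=
  interp_of_K s (fun t => ereal_inf [set y | exists v0 v1 g,
    [/\ isL2 O v0, isH1 O v1 g, forall x, O x -> v x = v0 x + v1 x &
      y = (L2norm O v0 ^+ 2 + (t ^+ 2)%:E * H1seminorm O g ^+ 2)%E]]).

Definition C_PF_SS {R : realType} {n : nat} (s : R) (O : set 'cV[R]_n) : R :=
  fine (lebesgue_cV O) `^ (- 2^-1) *
  Num.max 1 (2 `^ (- 2^-1) * diameter O `^ (n%:R / 2 + s)).

(* Main.v *)
(* On the reference domain, subtract the mean: neither seminorm changes, and for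
   a function of mean zero the L^2-norm is controlled by either seminorm.  For
   the Slobodeckij seminorm this follows by expanding |w(x) - w(y)|^2; for the
   interpolation seminorm it is the Poincare-Friedrichs hypothesis.  Norms and
   seminorms are then comparable on the reference domain, and the norm
   equivalence compares the two kinds of seminorms there.

   The seminorms on the image domain are compared with those on the reference
   domain by a linear change of variables.  For the Slobodeckij seminorm,
   |x - y| <= |B^-1| |B (x - y)|; for the interpolation seminorm, the gradient of
   v o F is B^T (grad v) o F, so that the K-functional of v o F at t is at most
   |det B|^-1 times that of v at |B| t. *)

Require Import Defs.
From HB Require Import structures.
From mathcomp Require Import all_boot all_order all_algebra.
From mathcomp Require Import all_classical all_reals all_analysis.
From mathcomp Require Import measurable_realfun ring lra.
Import Order.TTheory GRing.Theory Num.Theory.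
Import numFieldNormedType.Exports.

Set Implicit Arguments.
Unset Strict Implicit.
Unset Printing Implicit Defensive.

Local Open Scope classical_set_scope.
Local Open Scope ring_scope.

(** * Integrals of functions that need not be measurable *)

(** The K-functional is never shown to be measurable in [t], nor the inner Slobodeckij integral in
    [y]. Integrals of nonnegative functions are therefore handled as lower integrals: monotonicity
    and scaling survive, and subadditivity holds as soon as one summand is measurable. This is why
    the excess of the K-functional of the norm over three times that of the seminorm is dominated by
    explicit powers of [t], and why changes of variables are extended to arbitrary nonnegative
    functions. That the interpolation seminorm ignores constants is not formal: it rests on the
    vanishing of the integral over [O] of a partial derivative of a test function. The [3] of (i)
    bounds [1 + 2 t^2] for [t <= 1], and [1 / (s (1 - s))] bounds the integrals of the excess over
    [t <= 1] and [t >= 1]. The Slobodeckij double integral costs two determinant factors, of which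
    the K-functional gives one back. All transfer estimates are one-sided and are applied both to
    the affine map and to its inverse. *)

Section lower_integral.
Local Open Scope ereal_scope.
Context d (T : measurableType d) (R : realType).
Context (mu : {measure set T -> \bar R}).
Implicit Types (D : set T) (f g : T -> \bar R).

Import HBNNSimple.

(* The library's integral of a nonnegative function is a supremum over simple
   functions below it, hence a lower integral when it is not measurable. *)
Lemma ge0_integral_le_ub f (M : \bar R) : (forall x, 0 <= f x) ->
  (forall h : T -> R, measurable_fun setT h -> (forall x, 0 <= h x)%R ->
    (forall x, (h x)%:E <= f x) -> \int[mu]_x (h x)%:E <= M) ->
  \int[mu]_x f x <= M.
Proof.
move=> f0 H; rewrite ge0_integralTE//; apply: ge_ereal_sup => _ [h hf <-].
rewrite -integralT_nnsfun; apply: H => //.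
Qed.

Lemma ge0_le_lower_integral D f g : (forall x, D x -> 0 <= f x) ->
  (forall x, D x -> f x <= g x) ->
  \int[mu]_(x in D) f x <= \int[mu]_(x in D) g x.
Proof.
move=> f0 fg; have g0 x : D x -> 0 <= g x.
  by move=> Dx; exact: le_trans (f0 _ Dx) (fg _ Dx).
rewrite !ge0_integralE//; apply: ereal_sup_le => _ [h hf <-]; exists h => //= x.
by rewrite (le_trans (hf x))//; apply: lee_restrict.
Qed.

(** A measurable [h] below [c f] yields the competitor [c^-1 h] below [f]. *)
Lemma ge0_lower_integralZl_le D f (c : R) : (0 <= c)%R ->
  (forall x, D x -> 0 <= f x) ->
  \int[mu]_(x in D) (c%:E * f x) <= c%:E * \int[mu]_(x in D) f x.
Proof.
rewrite le_eqVlt => /predU1P[<- _|c0 f0].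
  by rewrite mul0e integral0_eq// => x _; rewrite mul0e.
rewrite !(integral_mkcond D).
apply: ge0_integral_le_ub => [|h mh h0 hf].
  by apply: erestrict_ge0 => x /f0 fx; rewrite mule_ge0// lee_fin ltW.
rewrite [leLHS](_ : _ = c%:E * \int[mu]_x (c^-1 * h x)%:E); last first.
  under [in RHS]eq_integral do rewrite EFinM.
  rewrite ge0_integralZl_EFin ?invr_ge0 ?ltW//.
  - by rewrite muleA -EFinM divff ?mul1e// gt_eqF.
  - by move=> x _; rewrite lee_fin.
  - exact/measurable_EFinP.
rewrite lee_pmul2l//; apply: ge0_le_lower_integral => x _.
  by rewrite lee_fin mulr_ge0// invr_ge0 ltW.
have := hf x; rewrite !patchE; case: ifPn => _ hx.
  by rewrite EFinM lee_pdivrMl.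
rewrite lee_fin in hx; rewrite lee_fin.
by rewrite (_ : h x = 0)%R ?mulr0//; apply/eqP; rewrite eq_le hx h0.
Qed.

(** The missing inequality is the previous lemma for the constant [c^-1] and the function [c f]. *)
Lemma ge0_lower_integralZl D f (c : R) : (0 < c)%R ->
  (forall x, D x -> 0 <= f x) ->
  \int[mu]_(x in D) (c%:E * f x) = c%:E * \int[mu]_(x in D) f x.
Proof.
move=> c0 f0; apply/eqP; rewrite eq_le (ge0_lower_integralZl_le (ltW c0))//=.
rewrite -lee_pdivlMl//.
rewrite (le_trans _ (ge0_lower_integralZl_le _ _))//.
- by under [leRHS]eq_integral do rewrite muleA -EFinM mulVf ?gt_eqF// mul1e.
- by rewrite invr_ge0 ltW.
- by move=> x /f0 fx; rewrite mule_ge0// lee_fin ltW.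
Qed.

(** Lower integrals are in general only superadditive. Here [g] is measurable and finite: for a
    measurable [h] below [f + g], the positive part of [h - g] is measurable and lies below [f]. *)
Lemma ge0_lower_integralD_le D f (g : T -> R) : measurable D ->
  measurable_fun D g ->
  (forall x, D x -> 0 <= f x) -> (forall x, D x -> 0 <= g x)%R ->
  \int[mu]_(x in D) (f x + (g x)%:E) <=
  \int[mu]_(x in D) f x + \int[mu]_(x in D) (g x)%:E.
Proof.
move=> mD mg f0 g0; rewrite !(integral_mkcond D).
have mg' : measurable_fun setT (g \_ D) by exact/(measurable_restrictT _ mD).1.
have g'0 x : (0 <= (g \_ D) x)%R.
  by rewrite patchE; case: ifPn => // /set_mem/g0.
apply: ge0_integral_le_ub => [|h mh h0 hf].
  by apply: erestrict_ge0 => x Dx; rewrite adde_ge0 ?f0// lee_fin g0.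
pose k x := Num.max (h x - (g \_ D) x)%R 0%R.
have mk : measurable_fun setT k.
  by apply: measurable_funrpos; exact: measurable_funB.
apply: (@le_trans _ _ (\int[mu]_x ((k x)%:E + ((g \_ D) x)%:E))).
  apply: ge0_le_lower_integral => x _; first by rewrite lee_fin.
  by rewrite -EFinD lee_fin /k -lerBlDr le_max lexx.
rewrite ge0_integralD//=.
- rewrite restrict_EFin; apply: leeD2r; apply: ge0_le_lower_integral => x _.
    by rewrite lee_fin /k le_max lexx orbT.
  have := hf x; rewrite /k /= !patchE; case: ifPn => [/set_mem Dx|_] hx.
    by rewrite EFin_max EFinB ge_max f0//= andbT EFinN leeBlDr.
  by rewrite subr0 lee_fin ge_max lexx andbT -lee_fin.
- by move=> x _; rewrite lee_fin /k le_max lexx orbT.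
- exact/measurable_EFinP.
- by move=> x _; rewrite lee_fin.
- exact/measurable_EFinP.
Qed.

End lower_integral.

(** * Affine changes of variables *)

Section lebesgue_measure_affine.
Context {R : realType}.
Local Notation leb := (@lebesgue_measure R).
Implicit Types a b : R.

Let measurable_affine a b :
  measurable_fun setT (fun t : measurableTypeR R => a * t + b : measurableTypeR R).
Proof. by apply: measurable_funD => //; exact: measurable_funM. Qed.

Let lebesgue_ocitv_affine a b (c d : R) : a != 0 ->
  leb `]c, d]%classic =
  (`|a|%:E * leb ((fun t => a * t + b)%R @^-1` `]c, d]%classic))%E.
Proof.
move=> a0; have an0 : 0 < `|a| by rewrite normr_gt0.
pose u := (c - b) / a; pose v := (d - b) / a.
(* For negative [a] the preimage is half-open on the other side, which does not change its
   length. *)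
have -> : leb ((fun t => a * t + b)%R @^-1` `]c, d]%classic) =
    leb (if 0 < a then `]u, v]%classic else `[v, u[%classic).
  congr (leb _); apply/seteqP; split => t; rewrite /u /v; case: ifPn => ha;
    rewrite /= !in_itv/=.
  - by rewrite ltr_pdivrMr// ler_pdivlMr// ltrBlDr lerBrDr (mulrC t).
  - have {}ha : a < 0 by rewrite lt_neqAle a0/= leNgt.
    by rewrite ltr_ndivlMr// ler_ndivrMr// ltrBlDr lerBrDr (mulrC t) andbC.
  - by rewrite ltr_pdivrMr// ler_pdivlMr// ltrBlDr lerBrDr (mulrC t).
  - have {}ha : a < 0 by rewrite lt_neqAle a0/= leNgt.
    by rewrite ltr_ndivlMr// ler_ndivrMr// ltrBlDr lerBrDr (mulrC t) andbC.
case: ifPn => ha; rewrite !lebesgue_measure_itv/= !lte_fin.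
  rewrite gtr0_norm// /u /v ltr_pM2r ?invr_gt0// ltrD2r.
  case: ifPn => _; rewrite ?mule0// -!EFinB -EFinM; congr EFin.
  by field.
have {}ha : a < 0 by rewrite lt_neqAle a0/= leNgt.
rewrite ltr0_norm// /u /v ltr_nM2r ?invr_lt0// ltrD2r.
case: ifPn => _; rewrite ?mule0// -!EFinB -EFinM; congr EFin.
by field.
Qed.

(** Uniqueness of Lebesgue measure: the pushforward scaled by [|a|] has the right values on
    half-open intervals. *)
Lemma lebesgue_measure_affine a b (A : set (measurableTypeR R)) : a != 0 ->
  measurable A ->
  leb A = (`|a|%:E * leb ((fun t => a * t + b)%R @^-1` A))%E.
Proof.
move=> a0.
pose nu := pushforward leb
  (fun t : measurableTypeR R => a * t + b : measurableTypeR R).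
pose nu' : {measure set (measurableTypeR R) -> \bar R} := HB.pack nu.
pose m : {measure set (measurableTypeR R) -> \bar R} :=
  mscale (NngNum (normr_ge0 a)) (nu' (measurable_affine a b)).
apply: (lebesgue_measure_unique (mu := m)) => _ [[c d]] _ <-.
exact: lebesgue_ocitv_affine.
Qed.

Lemma ge0_integral_affine a b (f : measurableTypeR R -> \bar R) : a != 0 ->
  measurable_fun setT f -> (forall t, 0 <= f t)%E ->
  (\int[leb]_t f t = `|a|%:E * \int[leb]_t f (a * t + b)%R)%E.
Proof.
move=> a0 mf f0.
pose nu := pushforward leb
  (fun t : measurableTypeR R => a * t + b : measurableTypeR R).
pose nu' : {measure set (measurableTypeR R) -> \bar R} := HB.pack nu.
pose m : {measure set (measurableTypeR R) -> \bar R} :=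
  mscale (NngNum (normr_ge0 a)) (nu' (measurable_affine a b)).
rewrite (eq_measure_integral m) => [|A mA _]; last first.
  exact: lebesgue_measure_affine.
rewrite ge0_integral_mscale//=; congr (_ * _)%E.
by rewrite ge0_integral_pushforward// => y _; exact: f0.
Qed.

End lebesgue_measure_affine.

Section lebesgue_cV_affine.
Context {R : realType}.
Local Notation leb := (@lebesgue_measure R).
Local Notation mu := lebesgue_cV.

Lemma measurable_fun_mulmx m n (B : 'M[R]_(m, n)) :
  measurable_fun setT (fun x : 'cV[R]_n => B *m x).
Proof.
apply/measurable_fun_cVP => i.
under eq_fun do rewrite mxE.
apply: measurable_sum => j.
by apply: measurable_funM => //; exact: measurable_coord.
Qed.

Lemma measurable_fun_addcV d (T : measurableType d) n (f g : T -> 'cV[R]_n) :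
  measurable_fun setT f -> measurable_fun setT g ->
  measurable_fun setT (fun x => f x + g x).
Proof.
move=> /measurable_fun_cVP mf /measurable_fun_cVP mg.
apply/measurable_fun_cVP => i; under eq_fun do rewrite mxE.
exact: (measurable_funD (mf i) (mg i)).
Qed.

Section iterated.
Context {n : nat} (f : 'cV[R]_n.+1 -> \bar R) (mf : measurable_fun setT f).
Context (f0 : forall x, (0 <= f x)%E).

Let mf_cons : measurable_fun setT
  (f \o cV_cons : measurableTypeR R * 'cV[R]_n -> \bar R).
Proof. exact: (measurableT_comp mf (@measurable_cV_cons R n)). Qed.

Let integral_lebesgue_cV_prod :
  (\int[mu]_x f x = \int[leb \x mu]_p f (cV_cons p))%E.
Proof.
pose m : {measure set (measurableTypeR R * 'cV[R]_n) -> \bar R} :=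
  (leb \x @lebesgue_cV R n)%E.
transitivity (\int[pushforward m cV_cons]_x f x)%E; first by [].
exact: (ge0_integral_pushforward (@measurable_cV_cons R n) m measurableT mf
  (fun y _ => f0 y)).
Qed.

Lemma integral_lebesgue_cVS1 :
  (\int[mu]_x f x = \int[leb]_t \int[mu]_y f (cV_cons (t, y)))%E.
Proof.
rewrite integral_lebesgue_cV_prod.
exact: (fubini_tonelli1 _ mf_cons (fun p => f0 _)).
Qed.

(** Integrating the head first suits matrices under which the new tail does not depend on the head;
    the opposite order suits shears of the tail along the head. *)
Lemma integral_lebesgue_cVS2 :
  (\int[mu]_x f x = \int[mu]_y \int[leb]_t f (cV_cons (t, y)))%E.
Proof.
rewrite integral_lebesgue_cV_prod.
exact: (fubini_tonelli2 _ mf_cons (fun p => f0 _)).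
Qed.

Lemma measurable_integral_cV_cons :
  measurable_fun setT (fun y : 'cV[R]_n => \int[leb]_t f (cV_cons (t, y)))%E.
Proof.
exact (@measurable_fun_fubini_tonelli_G _ _ _ _ _ leb _ mf_cons (fun p => f0 _)).
Qed.

Lemma measurable_fun_cV_cons_tail (t : R) :
  measurable_fun setT (fun y : 'cV[R]_n => f (cV_cons (t, y))).
Proof. exact: (measurableT_comp mf_cons (measurable_pair1 _)). Qed.

Lemma measurable_fun_cV_cons_head (y : 'cV[R]_n) :
  measurable_fun setT (fun t : measurableTypeR R => f (cV_cons (t, y))).
Proof. exact: (measurableT_comp mf_cons (measurable_pair2 _)). Qed.

End iterated.

Lemma cV_consD n (t u : R) (x y : 'cV[R]_n) :
  cV_cons (t + u, x + y) = cV_cons (t, x) + cV_cons (u, y).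
Proof. by rewrite /cV_cons [RHS](@add_col_mx _ 1 n 1)/= -raddfD. Qed.

Lemma cV_consK n (x : 'cV[R]_n.+1) :
  cV_cons (x 0 0, dsubmx (x : 'cV_(1 + n))) = x.
Proof.
apply: etrans (@vsubmxK _ 1 n 1 x); congr col_mx => /=.
rewrite [RHS]mx11_scalar mxE; congr (x _ _)%:M; exact/val_inj.
Qed.

(** Induction on the dimension: the head is translated by the one-dimensional formula, the tail by
    the induction hypothesis inside the integral. *)
Lemma ge0_integral_shift n (c : 'cV[R]_n) (f : 'cV[R]_n -> \bar R) :
  measurable_fun setT f -> (forall x, 0 <= f x)%E ->
  (\int[mu]_x f x = \int[mu]_x f (c + x)%R)%E.
Proof.
elim: n c f => [|n IH] c f mf f0.
  by apply: eq_integral => x _; congr f; apply/matrixP => -[].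
have mfc : measurable_fun setT (fun x => f (c + x)).
  apply: (measurableT_comp mf); exact: measurable_fun_addcV.
rewrite (integral_lebesgue_cVS1 mf f0).
rewrite (integral_lebesgue_cVS1 mfc (fun x => f0 _)).
set p := c 0 0; set q := dsubmx (c : 'cV_(1 + n)).
rewrite -(cV_consK c) -/p -/q.
pose g t := (\int[mu]_y f (cV_cons (t, y)))%E.
rewrite [LHS](@ge0_integral_affine _ 1 p)//; last 2 first.
- exact (@measurable_fun_fubini_tonelli_F _ _ _ _ _ (@lebesgue_cV R n) _
    (measurableT_comp mf (@measurable_cV_cons R n)) (fun p => f0 _)).
- by move=> t; apply: integral_ge0.
rewrite normr1 mul1e; apply: eq_integral => t _; rewrite mul1r addrC.
rewrite (IH q)//; last exact: measurable_fun_cV_cons_tail.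
by apply: eq_integral => y _; rewrite cV_consD.
Qed.

(** Phrased with integrals instead of measures of sets, so that it composes along matrix products
    and passes through iterated integrals. *)
Definition scales_integral n (B : 'M[R]_n) :=
  forall f : 'cV[R]_n -> \bar R, measurable_fun setT f ->
    (forall x, 0 <= f x)%E ->
  (\int[mu]_x f x = `|\det B|%:E * \int[mu]_x f (B *m x)%R)%E.

Lemma scales_integralM n (B C : 'M[R]_n) :
  scales_integral B -> scales_integral C -> scales_integral (B *m C).
Proof.
move=> HB HC f mf f0; rewrite HB// (HC (fun x => f (B *m x)))//; last first.
  exact: (measurableT_comp mf (measurable_fun_mulmx B)).
rewrite det_mulmx normrM EFinM -muleA; congr (_ * (_ * _))%E.
by apply: eq_integral => x _; rewrite mulmxA.
Qed.

Lemma block_mx_cV_cons n (a : R) (b : 'rV[R]_n) (c : 'cV[R]_n) (D : 'M[R]_n)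
    (t : R) (y : 'cV[R]_n) :
  (block_mx a%:M b c D : 'M[R]_n.+1) *m cV_cons (t, y) =
  cV_cons (a * t + (b *m y) 0 0, t *: c + D *m y).
Proof.
apply: etrans (@mul_block_col _ 1 n 1 n 1 _ _ _ _ _ _) _; congr col_mx.
  by rewrite -scalar_mxM [X in _ + X]mx11_scalar raddfD.
by rewrite mul_mx_scalar.
Qed.

(** The tail is mapped by [D] alone, and for a fixed tail [y] the head undergoes [t -> a t + b y]:
    the inner integral yields [|a|], the outer one [|det D|]. *)
Lemma scales_integral_ublock n (a : R) (b : 'rV[R]_n) (D : 'M[R]_n) :
  a != 0 -> scales_integral D ->
  scales_integral (block_mx a%:M b 0 D : 'M[R]_n.+1).
Proof.
move=> a0 HD f mf f0.
have mg : measurable_fun setT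
    (fun x => f ((block_mx a%:M b 0 D : 'M[R]_n.+1) *m x)).
  exact: (measurableT_comp mf (measurable_fun_mulmx _)).
rewrite (integral_lebesgue_cVS2 mf f0).
rewrite (integral_lebesgue_cVS2 mg (fun x => f0 _)).
rewrite (HD (fun y => \int[leb]_t f (cV_cons (t, y)))%E); last 2 first.
- exact: measurable_integral_cV_cons.
- by move=> y; exact: integral_ge0.
rewrite (@det_ublock _ 1 n) det_scalar1 normrM mulrC EFinM -muleA.
congr (_ * _)%E.
rewrite -ge0_integralZl_EFin//; last 2 first.
- by move=> y _; exact: integral_ge0.
- exact: (measurable_integral_cV_cons mg).
apply: eq_integral => y _.
rewrite (@ge0_integral_affine _ a ((b *m y) 0 0))//; last first.
  exact: measurable_fun_cV_cons_head.
congr (_ * _)%E; apply: eq_integral => t _.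
by rewrite block_mx_cV_cons scaler0 add0r.
Qed.

(** For a fixed head [t] the tail is translated by [t *: c], and the determinant is [1]. *)
Lemma scales_integral_lshear n (c : 'cV[R]_n) :
  scales_integral (block_mx 1%:M 0 c 1%:M : 'M[R]_n.+1).
Proof.
move=> f mf f0.
have mg : measurable_fun setT
    (fun x => f ((block_mx 1%:M 0 c 1%:M : 'M[R]_n.+1) *m x)).
  exact: (measurableT_comp mf (measurable_fun_mulmx _)).
rewrite (@det_lblock _ 1 n) !det1 mulr1 normr1 mul1e.
rewrite (integral_lebesgue_cVS1 mf f0).
rewrite (integral_lebesgue_cVS1 mg (fun x => f0 _)).
apply: eq_integral => t _.
rewrite (@ge0_integral_shift _ (t *: c))//; last exact: measurable_fun_cV_cons_tail.
apply: eq_integral => y _.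
by rewrite block_mx_cV_cons mul0mx mul1r mxE addr0 mul1mx.
Qed.

Lemma scales_integral1 n : scales_integral (1%:M : 'M[R]_n).
Proof.
move=> f mf f0; rewrite det1 normr1 mul1e.
by apply: eq_integral => x _; rewrite mul1mx.
Qed.

(* Block elimination on the first row and column; when the pivot vanishes, a
   shear adding a suitable row to the first one makes it nonzero. *)
Lemma scales_integral_unit n (B : 'M[R]_n) : B \in unitmx -> scales_integral B.
Proof.
elim: n B => [B _ f mf f0|n IH B uB].
  rewrite [B]flatmx0 -[X in \det X](flatmx0 1%:M) det1 normr1 mul1e.
  by apply: eq_integral => x _; congr f; apply/matrixP => -[].
have pivot (A : 'M[R]_(1 + n)) : A 0 0 != 0 -> A \in unitmx ->
    scales_integral (A : 'M[R]_n.+1).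
  move=> A00 uA; rewrite -[A]submxK.
  have -> : ulsubmx A = (A 0 0)%:M.
    rewrite [LHS]mx11_scalar !mxE; congr (A _ _)%:M; exact/val_inj.
  set a := A 0 0 in A00 *; set b := ursubmx A; set c := dlsubmx A.
  set D := drsubmx A.
  (* Schur complement of the pivot; it is invertible because [det A = a det S]. *)
  pose S := D - (a^-1 *: c) *m b.
  have E : block_mx a%:M b c D =
      block_mx 1%:M 0 (a^-1 *: c) 1%:M *m block_mx a%:M b 0 S.
    rewrite mulmx_block !mul1mx !mul0mx !addr0.
    by rewrite mul_mx_scalar scalerA divff// scale1r /S addrC subrK.
  rewrite E; apply: scales_integralM; first exact: scales_integral_lshear.
  apply: scales_integral_ublock => //; apply: IH.
  move: uA; rewrite -[A]submxK.
  have -> : ulsubmx A = a%:M.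
    rewrite [LHS]mx11_scalar !mxE; congr (A _ _)%:M; exact/val_inj.
  rewrite -/b -/c -/D E !unitmxE det_mulmx det_lblock det_ublock !det1 !mul1r.
  by rewrite unitrM => /andP[].
have [B00|] := eqVneq (B 0 0) 0; last by move=> ?; exact: pivot.
(* With a zero first column, [B] would kill the first basis vector. *)
have [i Bi0] : exists i, B i 0 != 0.
  apply: contrapT => /forallNP H.
  have : invmx B *m (B *m delta_mx 0 (0 : 'I_1)) = 0.
    rewrite [X in _ *m X](_ : _ = 0) ?mulmx0//; apply/matrixP => i j.
    rewrite -colE !mxE; apply/eqP; have := H i; by case: eqVneq.
  rewrite mulmxA mulVmx// mul1mx => /matrixP /(_ 0 0)/eqP.
  by rewrite !mxE !eqxx oner_eq0.
have [j ij] : exists j : 'I_n, i = rshift 1 j.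
  have [j ij|j ij] := split_ordP (i : 'I_(1 + n)); last by exists j.
  move: Bi0; rewrite ij (ord1 j) (_ : lshift n (0 : 'I_1) = 0 :> 'I_n.+1).
    by rewrite B00 eqxx.
  exact/val_inj.
(* [E 1] adds row [i] to the first row, so the new pivot is [B 0 0 + B i 0 = B i 0]; [E (-1)] undoes
   this. *)
pose E s : 'M[R]_(1 + n) := block_mx 1%:M (s *: delta_mx 0 j) 0 1%:M.
have EE : E (-1) *m E 1 = 1%:M.
  rewrite /E mulmx_block !mul1mx !mulmx1 !mul0mx !mulmx0 !addr0 !add0r.
  by rewrite scaleN1r scale1r subrr -scalar_mx_block.
have HE s : scales_integral (E s : 'M[R]_n.+1).
  apply: scales_integral_ublock; first exact: oner_neq0.
  exact: scales_integral1.
rewrite -[B]mul1mx -[X in X *m _]EE -mulmxA; apply: scales_integralM => //.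
apply: pivot; last first.
  by rewrite unitmx_mul uB andbT; case/mulmx1_unit: EE.
rewrite (_ : (E 1 *m B) 0 0 = B i 0) // /E scale1r.
rewrite -[B](@vsubmxK _ 1 n) (@mul_block_col _ 1 n 1 n n.+1).
have -> : (0 : 'I_n.+1) = lshift n (0 : 'I_1) by exact/val_inj.
rewrite [LHS](@col_mxEu _ 1 n) mul1mx mxE -rowE ij.
rewrite [RHS](@col_mxEd _ 1 n).
rewrite [X in X + _](_ : _ = 0); first by rewrite add0r [LHS]mxE.
by rewrite mxE -[RHS]B00; congr (B _ _); exact/val_inj.
Qed.

End lebesgue_cV_affine.

(** Lets the determinant factor out of a difference of positive and negative parts. When both are
    infinite, both sides are [-oo] by the convention for [+oo - +oo]. *)
Lemma pmule_subr (R : realType) (d : R) (a b : \bar R) : (0 < d)%R ->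
  (0 <= a -> 0 <= b -> d%:E * a - d%:E * b = d%:E * (a - b))%E.
Proof.
move=> d0; have dy : (d%:E * +oo = +oo)%E by rewrite gt0_muley ?lte_fin.
have dNy : (d%:E * -oo = -oo)%E by rewrite gt0_muleNy ?lte_fin.
case: a => [a||]//; case: b => [b||]// _ _; rewrite ?dy.
- exact: (congr1 EFin (esym (mulrBr _ _ _))).
- exact: esym dNy.
- by [].
- exact: esym dNy.
Qed.

Section affine_map.
Context {R : realType} {n : nat}.
Local Notation mu := (@lebesgue_cV R n).
Implicit Types (B : 'M[R]_n) (c : 'cV[R]_n) (A : set 'cV[R]_n).

Definition affine_map c B (x : 'cV[R]_n) := c + B *m x.

Lemma affine_mapK c B : B \in unitmx ->
  cancel (affine_map c B) (affine_map (- invmx B *m c) (invmx B)).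
Proof.
by move=> uB x; rewrite /affine_map mulmxDr mulKmx// mulNmx addKr.
Qed.

Lemma affine_mapVK c B : B \in unitmx ->
  cancel (affine_map (- invmx B *m c) (invmx B)) (affine_map c B).
Proof.
by move=> uB x; rewrite /affine_map mulmxDr mulNmx mulmxN !mulKVmx// addrA subrr add0r.
Qed.

Lemma affine_mapB c B x y :
  affine_map c B x - affine_map c B y = B *m (x - y).
Proof. by rewrite /affine_map mulmxBr opprD addrACA subrr add0r. Qed.

Lemma image_affine_map c B A : B \in unitmx ->
  affine_map c B @` A = affine_map (- invmx B *m c) (invmx B) @^-1` A.
Proof.
move=> uB; apply/seteqP; split => [_ [x Ax <-]|x Ax] /=.
  by rewrite affine_mapK.
by exists (affine_map (- invmx B *m c) (invmx B) x) => //; rewrite affine_mapVK.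
Qed.

Lemma measurable_affine_map c B : measurable_fun setT (affine_map c B).
Proof. by apply: measurable_fun_addcV => //; exact: measurable_fun_mulmx. Qed.

Lemma measurable_image_affine_map c B A : B \in unitmx ->
  measurable A -> measurable (affine_map c B @` A).
Proof.
move=> uB mA; rewrite image_affine_map// -[X in measurable X]setTI.
exact: measurable_affine_map.
Qed.

Local Open Scope ereal_scope.

Let ge0_measurable_integral_affine_map c B (f : 'cV[R]_n -> \bar R) :
  B \in unitmx -> measurable_fun setT f -> (forall x, 0 <= f x) ->
  \int[mu]_x f x = `|\det B|%:E * \int[mu]_x f (affine_map c B x).
Proof.
move=> uB mf f0; rewrite (ge0_integral_shift c)//.
rewrite (scales_integral_unit uB)//.
by apply: (measurableT_comp mf); exact: measurable_fun_addcV.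
Qed.

(** The formula for measurable functions is applied to each measurable [h] below [f], whose
    composite lies below that of [f]. *)
Let ge0_integral_affine_map_le c B (f : 'cV[R]_n -> \bar R) :
  B \in unitmx -> (forall x, 0 <= f x) ->
  \int[mu]_x f x <= `|\det B|%:E * \int[mu]_x f (affine_map c B x).
Proof.
move=> uB f0; apply: ge0_integral_le_ub => // h mh h0 hf.
rewrite [leLHS](ge0_measurable_integral_affine_map c (f := EFin \o h) uB); last 2 first.
- exact/measurable_EFinP.
- by move=> x; rewrite lee_fin.
apply: lee_wpmul2l; first by rewrite lee_fin.
apply: ge0_le_lower_integral => x _; last exact: hf.
by rewrite /= lee_fin.
Qed.

Lemma normr_det_gt0 B : B \in unitmx -> (0 < `|\det B|)%R.
Proof. by rewrite unitmxE unitfE normr_gt0. Qed.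

Lemma normr_det_inv B : `|\det (invmx B)|%R = `|\det B|^-1%R.
Proof. by rewrite det_inv normfV. Qed.

(** The opposite inequality is the previous one for the inverse map, whose determinant is the
    inverse. *)
Let ge0_integral_affine_mapT c B (f : 'cV[R]_n -> \bar R) :
  B \in unitmx -> (forall x, 0 <= f x) ->
  \int[mu]_x f x = `|\det B|%:E * \int[mu]_x f (affine_map c B x).
Proof.
move=> uB f0; apply/eqP; rewrite eq_le ge0_integral_affine_map_le//=.
rewrite -lee_pdivlMl ?normr_det_gt0//.
have uBV : invmx B \in unitmx by rewrite unitmx_inv.
apply: (le_trans (@ge0_integral_affine_map_le (- invmx B *m c)%R _
  (fun x => f (affine_map c B x)) uBV (fun x => f0 _))).
rewrite normr_det_inv; apply: lee_wpmul2l; first by rewrite lee_fin invr_ge0.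
by under eq_integral do rewrite affine_mapVK//.
Qed.

Lemma ge0_integral_affine_map c B A (f : 'cV[R]_n -> \bar R) :
  B \in unitmx -> (forall x, (affine_map c B @` A) x -> 0 <= f x) ->
  \int[mu]_(x in affine_map c B @` A) f x =
  `|\det B|%:E * \int[mu]_(x in A) f (affine_map c B x).
Proof.
move=> uB f0; rewrite integral_mkcond [in RHS]integral_mkcond.
rewrite (ge0_integral_affine_mapT c uB); last by apply: erestrict_ge0.
congr (_ * _); apply: eq_integral => x _; rewrite !patchE.
suff -> : (affine_map c B x \in affine_map c B @` A) = (x \in A) by [].
by apply/idP/idP; rewrite !inE image_affine_map//= affine_mapK.
Qed.

Lemma integral_affine_map c B A (f : 'cV[R]_n -> \bar R) : B \in unitmx ->
  \int[mu]_(x in affine_map c B @` A) f x =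
  `|\det B|%:E * \int[mu]_(x in A) f (affine_map c B x).
Proof.
move=> uB; rewrite integralE !ge0_integral_affine_map//.
rewrite [LHS](pmule_subr (normr_det_gt0 uB)) ?integral_ge0//.
congr (_ * _); rewrite [RHS]integralE.
by congr (_ - _); apply: eq_integral => x _; rewrite unlock.
Qed.

End affine_map.

(** * Euclidean norm and operator norm *)

Section euclidean_norm.
Context {R : realType} {n : nat}.
Implicit Types (x y : 'cV[R]_n) (B : 'M[R]_n).

Lemma enorm_ge0 x : 0 <= enorm x. Proof. exact: sqrtr_ge0. Qed.

Lemma enorm_sqr x : enorm x ^+ 2 = \sum_i x i 0 ^+ 2.
Proof. by rewrite sqr_sqrtr// sumr_ge0// => i _; exact: sqr_ge0. Qed.

Lemma enorm0 : enorm (0 : 'cV[R]_n) = 0.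
Proof. by rewrite /enorm big1 ?sqrtr0// => i _; rewrite mxE expr0n. Qed.

Lemma enorm_eq0 x : (enorm x == 0) = (x == 0).
Proof.
apply/idP/idP => [/eqP x0|/eqP->]; last by rewrite enorm0.
have /eqP := enorm_sqr x; rewrite x0 expr0n eq_sym psumr_eq0 => [/allP h|i _].
  apply/eqP/matrixP => i j; rewrite (ord1 j) mxE; apply/eqP.
  by have := h i (mem_index_enum i); rewrite sqrf_eq0.
exact: sqr_ge0.
Qed.

Lemma enormZ (a : R) x : enorm (a *: x) = `|a| * enorm x.
Proof.
rewrite /enorm -sqrtr_sqr -sqrtrM ?sqr_ge0//; congr Num.sqrt.
by rewrite mulr_sumr; apply: eq_bigr => i _; rewrite mxE exprMn.
Qed.

Lemma cauchy_schwarz_cV x y : \sum_i x i 0 * y i 0 <= enorm x * enorm y.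
Proof.
have [->|x0] := eqVneq x 0.
  by rewrite enorm0 mul0r big1// => i _; rewrite mxE mul0r.
have [->|y0] := eqVneq y 0.
  by rewrite enorm0 mulr0 big1// => i _; rewrite mxE mulr0.
set a := enorm x; set b := enorm y.
have ab0 : 0 < a * b.
  by rewrite mulr_gt0// lt_neqAle eq_sym enorm_eq0 ?x0 ?y0 enorm_ge0.
(* With [a] and [b] the two norms, this sum equals [2 a b (a b - x . y)]. *)
have : 0 <= \sum_i (b * x i 0 - a * y i 0) ^+ 2.
  by apply: sumr_ge0 => i _; exact: sqr_ge0.
under eq_bigr do rewrite sqrrB.
rewrite big_split/= sumrB.
under [X in X - _ + _]eq_bigr do rewrite exprMn.
under [X in _ - X + _]eq_bigr do rewrite mulrACA -mulrnAr.
under [X in _ + X]eq_bigr do rewrite exprMn.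
rewrite -!mulr_sumr -!enorm_sqr sumrMnl -/a -/b => h.
have : 0 <= (a * b) * (a * b - \sum_i x i 0 * y i 0) by nra.
by rewrite pmulr_rge0// subr_ge0.
Qed.

Lemma cauchy_schwarz_cV_norm x y : `|\sum_i x i 0 * y i 0| <= enorm x * enorm y.
Proof.
rewrite ler_norml cauchy_schwarz_cV andbT lerNl -sumrN.
have := cauchy_schwarz_cV (- x) y; rewrite -scaleN1r enormZ normrN1 mul1r.
by apply: le_trans; apply: ler_sum => i _; rewrite !mxE mulN1r mulNr.
Qed.

(** The Frobenius norm; it serves to bound the set whose supremum is [opnorm B]. *)
Let frob B := Num.sqrt (\sum_i enorm (row i B)^T ^+ 2).

Let le_enorm_frob B x : enorm (B *m x) <= frob B * enorm x.
Proof.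
rewrite -ler_sqr ?nnegrE ?mulr_ge0 ?sqrtr_ge0 ?enorm_ge0//.
rewrite exprMn [frob B ^+ 2]sqr_sqrtr; last first.
  by rewrite sumr_ge0// => i _; exact: sqr_ge0.
rewrite [leLHS]enorm_sqr mulr_suml; apply: ler_sum => i _.
rewrite -exprMn -[leLHS]real_normK ?num_real//.
rewrite ler_sqr ?nnegrE ?mulr_ge0 ?enorm_ge0//.
apply: le_trans (cauchy_schwarz_cV_norm _ _); rewrite mxE.
by under [in leRHS]eq_bigr do rewrite !mxE.
Qed.

Let opnorm_has_sup B :
  has_sup [set enorm (B *m x) | x in [set x : 'cV[R]_n | enorm x <= 1]].
Proof.
split; first by exists (enorm (B *m 0)), 0 => //=; rewrite enorm0.
exists (frob B) => _ [x /= x1 <-].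
by rewrite (le_trans (le_enorm_frob _ _))// ler_piMr// sqrtr_ge0.
Qed.

Lemma le_opnorm B x : enorm (B *m x) <= opnorm B * enorm x.
Proof.
have [->|x0] := eqVneq x 0; first by rewrite mulmx0 enorm0 mulr0.
have x0' : 0 < enorm x by rewrite lt_neqAle eq_sym enorm_eq0 x0 enorm_ge0.
rewrite -ler_pdivrMr// mulrC -[X in X * _]ger0_norm ?invr_ge0 ?enorm_ge0//.
rewrite -enormZ scalemxAr; apply: ub_le_sup; first by case: (opnorm_has_sup B).
exists ((enorm x)^-1 *: x) => //=.
by rewrite enormZ ger0_norm ?invr_ge0 ?enorm_ge0// mulVf// gt_eqF.
Qed.

Lemma opnorm_ge0 B : 0 <= opnorm B.
Proof.
apply: ub_le_sup; first by case: (opnorm_has_sup B).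
by exists 0 => /=; rewrite ?mulmx0 enorm0.
Qed.

(** [|B^T x|^2 = x . B (B^T x) <= |x| |B| |B^T x|], then divide by [|B^T x|]. Gradients are
    transformed by the transpose, while the estimates involve the norm of [B] itself. *)
Lemma le_opnorm_tr B x : enorm (B^T *m x) <= opnorm B * enorm x.
Proof.
have [->|y0] := eqVneq (B^T *m x) 0.
  by rewrite enorm0 mulr_ge0 ?opnorm_ge0 ?enorm_ge0.
have y0' : 0 < enorm (B^T *m x) by rewrite lt_neqAle eq_sym enorm_eq0 y0 enorm_ge0.
rewrite -(ler_pM2r y0') -expr2 enorm_sqr.
rewrite [leLHS](_ : _ = \sum_i x i 0 * (B *m (B^T *m x)) i 0); last first.
  transitivity ((((B^T *m x)^T *m (B^T *m x))) 0 0).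
    by rewrite [RHS]mxE; apply: eq_bigr => i _; rewrite [in RHS]mxE expr2.
  rewrite trmx_mul trmxK -mulmxA [LHS]mxE.
  by apply: eq_bigr => i _; rewrite [in LHS]mxE.
rewrite (le_trans (cauchy_schwarz_cV _ _))//.
by rewrite (mulrC (opnorm B)) -mulrA ler_wpM2l ?enorm_ge0 ?le_opnorm.
Qed.

End euclidean_norm.

(** In dimension zero the operator norm is [0]. Positivity is what permits the substitution of
    [opnorm B * t] for [t]. *)
Lemma opnorm_gt0 (R : realType) n (B : 'M[R]_n) : (0 < n)%N -> B \in unitmx ->
  0 < opnorm B.
Proof.
case: n B => // m B _ uB; rewrite lt_neqAle opnorm_ge0 andbT; apply/eqP => B0.
pose e : 'cV[R]_m.+1 := delta_mx 0 0.
have : enorm (B *m e) <= 0 by rewrite (le_trans (le_opnorm _ _))// -B0 mul0r.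
rewrite le_eqVlt ltNge enorm_ge0 orbF enorm_eq0 => /eqP Be.
have := congr1 (mulmx (invmx B)) Be; rewrite mulKmx// mulmx0.
by move=> /matrixP/(_ 0 0)/eqP; rewrite !mxE !eqxx oner_eq0.
Qed.

(** * Smooth functions and affine maps *)

Section smooth_functions.
Context {R : realType} {n : nat}.
Implicit Types (f g phi : 'cV[R]_n -> R) (B : 'M[R]_n) (c v : 'cV[R]_n).

Lemma continuous_measurable_cV f : continuous f -> measurable_fun setT f.
Proof.
move=> cf; apply: (measurability _ (RGenOpens.measurableE R)).
move=> _ [_ [a [b ->] <-]]; rewrite setTI; apply: open_measurable_cV.
by move/continuousP : cf; apply; exact: interval_open.
Qed.

Lemma continuous_affine_map c B : continuous (affine_map c B).
Proof.
move=> x; apply/(@cvg_ballP _ _ _ _ (nbhs_filter x)) => e e0.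
have ci (i : 'I_n) : continuous (fun y => affine_map c B y i 0).
  rewrite (_ : (fun y => _) =
      fun y : 'cV[R]_n => c i 0 + \sum_j B i j * y j 0); last first.
    by apply/funext => y; rewrite !mxE.
  move=> y; apply: continuousD; first exact: cst_continuous.
  suff cs : continuous (fun y : 'cV[R]_n => \sum_j B i j * y j 0) by exact: cs.
  apply: continuous_big => [|j _ z]; first exact: add_continuous.
  apply: continuousM; first exact: cst_continuous.
  exact: coord_continuous.
have h (i : 'I_n) : \forall y \near x,
    ball (affine_map c B x i 0) e (affine_map c B y i 0).
  exact: (@cvg_ball _ _ _ _ (nbhs_filter x) _ _ (ci i x) _ e0).
have := @filter_forall _ _ _ _ (nbhs_filter x) h.
by apply: filterS => y hy; split => // i j; rewrite (ord1 j); exact: hy.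
Qed.

Lemma differentiable_affine_map c B x : differentiable (affine_map c B) x.
Proof.
apply: differentiableD; first exact: differentiable_cst.
have E : (mulmx B : 'cV[R]_n -> 'cV[R]_n) = affine_map 0 B.
  by apply/funext => y; rewrite /affine_map add0r.
have cB : continuous (mulmx B : 'cV[R]_n -> 'cV[R]_n).
  by rewrite E; exact: continuous_affine_map.
exact: (@linear_differentiable _ _ _
  (mulmx B : {linear 'cV[R]_n -> 'cV[R]_n}) x cB).
Qed.

(** The two difference quotients coincide as functions of [h], hence so do their limits. *)
Lemma derive_comp_affine_map f c B v x :
  'D_v (f \o affine_map c B) x = 'D_(B *m v) f (affine_map c B x).
Proof.
have E : (fun h : R => h^-1 *: (((f \o affine_map c B) \o shift x) (h *: v) -
      (f \o affine_map c B) x)) =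
    (fun h => h^-1 *: ((f \o shift (affine_map c B x)) (h *: (B *m v)) -
      f (affine_map c B x))).
  apply/funext => h /=; congr (_ *: (f _ - _)).
  by rewrite /affine_map/= mulmxDr -scalemxAr addrCA.
by rewrite /derive E.
Qed.

Lemma partial_comp_affine_map f c B i : (forall x, differentiable f x) ->
  partial i (f \o affine_map c B) =
  \sum_j (B j i *: (partial j f \o affine_map c B)).
Proof.
move=> df; apply/funext => x; rewrite /partial derive_comp_affine_map.
have -> : B *m delta_mx i 0 = \sum_j B j i *: delta_mx j (0 : 'I_1).
  apply/matrixP => k l; rewrite (ord1 l) -colE mxE summxE (bigD1 k)//= big1.
    by rewrite !mxE !eqxx mulr1 addr0.
  by move=> j jk; rewrite !mxE eq_sym (negbTE jk) mulr0.
rewrite deriveE// raddf_sum fct_sumE; apply: eq_bigr => j _.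
by apply: etrans (linearZZ _ _ _) _; rewrite -deriveE.
Qed.

(** Bounding the order provides the induction for composites with affine maps: a partial derivative
    of the composite is a linear combination of composites of partial derivatives, to be controlled
    to one order less. *)
Definition smooth_upto (k : nat) f := forall (l : seq 'I_n), (size l <= k)%N ->
  forall x, differentiable (foldr partial f l) x.

Lemma smoothP f : smooth f <-> forall k, smooth_upto k f.
Proof. by split=> [sf k l _ x|sf l x]; [exact: sf|exact: (sf (size l))]. Qed.

Lemma smooth_differentiable f : smooth f -> forall x, differentiable f x.
Proof. by move=> sf x; exact: (sf [::]). Qed.

Lemma smooth_partial f i : smooth f -> smooth (partial i f).
Proof. by move=> sf l x; rewrite -foldr_rcons; exact: sf. Qed.

Lemma smooth_uptoS k f : (forall x, differentiable f x) ->
  (forall i, smooth_upto k (partial i f)) -> smooth_upto k.+1 f.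
Proof.
(* [foldr] differentiates first in the last index of [l], so peeling [l] from the right exposes
   [partial i f]. *)
move=> df sf l; case/lastP: l => [//|l i]; rewrite size_rcons foldr_rcons => lk.
exact: sf.
Qed.

Let foldr_partialD k f g l : (size l <= k)%N -> smooth_upto k f ->
  smooth_upto k g ->
  foldr partial (f + g) l = foldr partial f l + foldr partial g l.
Proof.
move=> + sf sg; elim: l => //= i l IH lk.
have {}lk' := ltnW lk; rewrite IH//; apply/funext => x.
rewrite /partial deriveD//; apply: diff_derivable; [exact: sf|exact: sg].
Qed.

Let foldr_partialZ k f (a : R) l : (size l <= k)%N -> smooth_upto k f ->
  foldr partial (a *: f) l = a *: foldr partial f l.
Proof.
move=> + sf; elim: l => //= i l IH lk.
have {}lk' := ltnW lk; rewrite IH//; apply/funext => x.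
rewrite /partial (deriveZ (f := foldr partial f l))//.
by apply: diff_derivable; exact: sf.
Qed.

Lemma smooth_uptoD k f g : smooth_upto k f -> smooth_upto k g ->
  smooth_upto k (f + g).
Proof.
move=> sf sg l lk x; rewrite (foldr_partialD lk)//.
by apply: differentiableD; [exact: sf|exact: sg].
Qed.

Lemma smooth_uptoZ k f (a : R) : smooth_upto k f -> smooth_upto k (a *: f).
Proof.
move=> sf l lk x; rewrite (foldr_partialZ _ lk)//.
by apply: differentiableZ; exact: sf.
Qed.

Lemma smooth_upto_sum k (I : Type) (r : seq I) (F : I -> 'cV[R]_n -> R) :
  (forall i, smooth_upto k (F i)) -> smooth_upto k (\sum_(i <- r) F i).
Proof.
move=> sF; apply: (big_ind (smooth_upto k)) => // [|f g]; last exact: smooth_uptoD.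
move=> l lk x; rewrite (_ : foldr _ _ _ = 0); first exact: differentiable_cst.
elim: l {lk} => //= i l ->; apply/funext => y; rewrite /partial.
exact: derive_cst.
Qed.

Lemma smooth_comp_affine_map f c B : smooth f -> smooth (f \o affine_map c B).
Proof.
move=> sf; apply/smoothP => k; elim: k f sf => [|k IH] f sf.
  move=> [|//] _ x; apply: differentiable_comp; last exact: smooth_differentiable.
  exact: differentiable_affine_map.
apply: smooth_uptoS => [x|i].
  apply: differentiable_comp; last exact: smooth_differentiable.
  exact: differentiable_affine_map.
rewrite partial_comp_affine_map; last exact: smooth_differentiable.
apply: smooth_upto_sum => j; apply: smooth_uptoZ; apply: IH.
exact: smooth_partial.
Qed.

End smooth_functions.

(** * Volume and diameter of bounded sets *)

Section bounded_sets.
Context {R : realType}.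
Local Notation mu := lebesgue_cV.

Let cube n (r : R) := [set x : 'cV[R]_n | forall i, `|x i 0| <= r].

Let measurable_cube n r : measurable (@cube n r).
Proof.
rewrite (_ : cube r = \bigcap_(i in [set: 'I_n])
    (fun x : 'cV[R]_n => x i 0 : measurableTypeR R) @^-1` `[- r, r]%classic).
  apply: fin_bigcap_measurable => // i _.
  by rewrite -[X in measurable X]setTI; exact: measurable_coord.
apply/seteqP; split => [x xr i _|x xr i].
  by rewrite /= in_itv/= -ler_norml; exact: xr.
by have := xr i I; rewrite /= in_itv/= -ler_norml.
Qed.

Let lebesgue_cV_cube n r : (mu (@cube n r) < +oo)%E.
Proof.
elim: n => [|n IH]; first by rewrite /= diracE ltey.
rewrite (_ : mu (cube r) =
    (@lebesgue_measure R \x @lebesgue_cV R n)%E (`[- r, r]%classic `*` cube r)).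
  rewrite product_measure1E//; last exact: measurable_cube.
  apply: lte_mul_pinfty => //.
  have itv_lty : (@lebesgue_measure R `[(- r)%R, r]%classic < +oo)%E.
    by rewrite lebesgue_measure_itv/=; case: ifPn => //= _; rewrite ltey.
  by rewrite ge0_fin_numE.
rewrite /= /pushforward; congr ((_ \x _)%E _); apply/seteqP; split => -[t y] /=.
  move=> h; split.
    have := h 0; rewrite (_ : cV_cons (t, y) 0 0 = t) ?in_itv/= ?ler_norml//.
    have -> : (0 : 'I_n.+1) = lshift n (0 : 'I_1) by exact/val_inj.
    by rewrite [LHS](@col_mxEu _ 1 n) mxE.
  by move=> i; have := h (rshift 1 i); rewrite [X in `|X|](@col_mxEd _ 1 n).
rewrite in_itv/= -ler_norml => -[tr yr] i.
have [j ->|j ->] := split_ordP (i : 'I_(1 + n)).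
  by rewrite [X in `|X|](@col_mxEu _ 1 n) (ord1 j) mxE.
by rewrite [X in `|X|](@col_mxEd _ 1 n).
Qed.

Lemma ler_abs_mx_norm n (x : 'cV[R]_n) i : `|x i 0| <= `|x|.
Proof.
rewrite [leRHS]mx_normrE.
exact: (le_bigmax 0 (fun ij : 'I_n * 'I_1 => `|x ij.1 ij.2|) (i, 0)).
Qed.

Lemma bounded_lebesgue_cV_lty n (A : set 'cV[R]_n) : measurable A ->
  bounded_set A -> (mu A < +oo)%E.
Proof.
move=> mA [M [_ /(_ (M + 1))]]; rewrite ltrDl ltr01 => /(_ isT) AM.
apply: le_lt_trans (lebesgue_cV_cube n (M + 1)).
apply: (le_measure (@lebesgue_cV R n)); rewrite ?inE//.
by move=> x Ax i; exact: le_trans (ler_abs_mx_norm _ _) (AM _ Ax).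
Qed.

Lemma bounded_diameter n (A : set 'cV[R]_n) x y : bounded_set A ->
  A x -> A y -> enorm (x - y) <= diameter A.
Proof.
move=> [M [_ /(_ (M + 1))]]; rewrite ltrDl ltr01 => /(_ isT) AM Ax Ay.
apply: ub_le_sup; last by exists x, y.
(* The coordinates of points of [A] are bounded by [M + 1], since boundedness supplies every bound
   above [M]; those of a difference are bounded by twice that. *)
exists (Num.sqrt (\sum_(i < n) (2 * (M + 1)) ^+ 2)) => _ [a [b [Aa Ab ->]]].
apply: ler_wsqrtr; apply: ler_sum => i _.
rewrite -[leLHS]real_normK ?num_real// ler_sqr ?nnegrE; last first.
- by rewrite mulr_ge0// (le_trans _ (AM _ Aa)).
- by [].
rewrite mxE (le_trans (ler_normD _ _))// mulr2n mulrDl mul1r lerD//.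
  by rewrite (le_trans (ler_abs_mx_norm _ _))//; exact: AM.
by rewrite mxE normrN (le_trans (ler_abs_mx_norm _ _))//; exact: AM.
Qed.

End bounded_sets.

(** * Test functions: supports, affine maps, integrals of derivatives *)

Section test_functions.
Context {R : realType} {n : nat}.
Implicit Types (O A : set 'cV[R]_n) (phi : 'cV[R]_n -> R) (B : 'M[R]_n).
Local Notation mu := (@lebesgue_cV R n).

Lemma test_fun_continuous O phi : test_fun O phi -> continuous phi.
Proof.
by move=> [sphi _ _] x; apply: differentiable_continuous; exact: smooth_differentiable.
Qed.

Lemma notin_support_eq0 phi x :
  ~ closure [set x | phi x != 0] x -> phi x = 0.
Proof.
move=> Nx; apply/eqP/negPn/negP => px; apply: Nx; exact: subset_closure.
Qed.

Lemma partial_eq0 phi i x : ~ closure [set x | phi x != 0] x ->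
  partial i phi x = 0.
Proof.
move=> Nx; rewrite /partial (@near_eq_derive _ _ _ phi (cst 0)) ?derive_cst//.
have : nbhs x (~` closure [set x | phi x != 0]).
  by apply: open_nbhs_nbhs; split => //; exact/closed_openC/closed_closure.
apply: filterS => y Ny; apply/eqP/negPn/negP => py; apply: Ny.
exact: subset_closure.
Qed.

Lemma test_fun_partial O phi i : test_fun O phi -> test_fun O (partial i phi).
Proof.
move=> [sphi cphi Ophi].
have sub : closure [set x | partial i phi x != 0] `<=` closure [set x | phi x != 0].
  rewrite [X in _ `<=` X](closure_id _).1; last exact: closed_closure.
  apply: closure_subset => x /=; apply: contraNP => Nx; apply/eqP.
  exact: partial_eq0.
split; first exact: smooth_partial.
- by apply: subclosed_compact cphi sub; exact: closed_closure.
- exact: subset_trans sub Ophi.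
Qed.

Lemma test_fun_bounded O phi : test_fun O phi -> exists M : R, forall x, `|phi x| <= M.
Proof.
move=> tphi; have [_ cphi _] := tphi.
have : compact (phi @` closure [set x | phi x != 0]).
  apply: continuous_compact => //; apply: continuous_subspaceT.
  exact: test_fun_continuous tphi.
move=> /compact_bounded[M [_ /(_ (`|M| + 1))]].
rewrite (le_lt_trans (ler_norm _)) ?ltrDl// => /(_ isT) HM.
exists (`|M| + 1) => x.
have [cx|Ncx] := pselect (closure [set x | phi x != 0] x).
  by apply: HM; exists x.
by rewrite notin_support_eq0// normr0 addr_ge0.
Qed.

Lemma test_fun_affine_map O phi c B : B \in unitmx -> test_fun O phi ->
  test_fun (affine_map c B @` O)
    (phi \o affine_map (- invmx B *m c) (invmx B)).
Proof.
move=> uB [sphi cphi Ophi].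
set S := closure [set x | phi x != 0] in cphi Ophi.
have cFS : compact (affine_map c B @` S).
  apply: continuous_compact => //; apply: continuous_subspaceT.
  exact: continuous_affine_map.
(* The image of the compact support is closed, so it contains the closure of the nonvanishing
   set. *)
have sub : closure [set x | (phi \o affine_map (- invmx B *m c) (invmx B)) x != 0]
    `<=` affine_map c B @` S.
  rewrite [X in _ `<=` X](closure_id _).1; last first.
    by apply: compact_closed => //; exact: norm_hausdorff.
  apply: closure_subset => x px; rewrite image_affine_map//=.
  exact: subset_closure.
split; first exact: smooth_comp_affine_map.
- by apply: subclosed_compact cFS sub; exact: closed_closure.
- by apply: subset_trans sub _; exact: image_subset.
Qed.

(* By translation invariance [t |-> \int phi (x + t e_i)] is constant; differentiate
   it under the integral sign. *)
Lemma integral_partial_test_fun O phi i : measurable O -> test_fun O phi ->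
  \int[mu]_(x in O) partial i phi x = 0.
Proof.
move=> mO tphi; have [sphi cphi Ophi] := tphi.
set S := closure [set x | phi x != 0] in cphi Ophi.
set e : 'cV[R]_n := delta_mx i 0.
have [M HM] := test_fun_bounded (test_fun_partial i tphi).
have [N HN] := test_fun_bounded tphi.
have [L HL] : exists L, forall x, S x -> `|x| <= L.
  have [L [_ /(_ (L + 1))]] := compact_bounded cphi.
  by rewrite ltrDl ltr01 => /(_ isT) HL; exists (L + 1) => x /HL.
(* A set of finite measure containing the supports of all translates [phi (x + t e)] with [|t| < 1];
   constants are integrable on it and can dominate the derivatives. *)
pose D := [set x : 'cV[R]_n | `|x| < L + `|e| + 1].
have mD : measurable D.
  apply: open_measurable_cV.
  by apply: (@open_comp _ _ (fun x : 'cV[R]_n => `|x|)) (@open_lt R _) => x _;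
    exact: norm_continuous.
have Doo : (mu D < +oo)%E.
  apply: bounded_lebesgue_cV_lty => //; exists (L + `|e| + 1).
  split => [|r hr x]; first exact: num_real.
  by rewrite /D/= => /ltW/le_trans; apply; exact: ltW.
have SD t x : `|t| < 1 -> S (x + t *: e) -> D x.
  move=> t1 /HL h; rewrite /D/= -[x in `|x|](addrK (t *: e)).
  rewrite (le_lt_trans (ler_normB _ _))// normrZ -addrA.
  rewrite ler_ltD// (le_lt_trans (ler_piMl _ (ltW t1)))// ltrDl//.
pose f t x := phi (x + t *: e).
have mphi := continuous_measurable_cV (test_fun_continuous tphi).
have mf t : measurable_fun setT (f t).
  apply: (measurableT_comp mphi).
  by apply: measurable_fun_addcV.
have intf t : mu.-integrable D (EFin \o f t).
  apply: measurable_bounded_integrable => //; first exact: measurable_funTS.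
  exists N; split; first exact: num_real.
  by move=> r Nr x _ /=; rewrite (le_trans (HN _)) ?ltW.
have df t x : derivable (f ^~ x) t 1 /\ partial1of2 f t x = partial i phi (x + t *: e).
  have E : (fun h : R => h^-1 *: (((f^~ x) \o shift t) (h *: 1) - (f^~ x) t)) =
      (fun h => h^-1 *: ((phi \o shift (x + t *: e)) (h *: e) - phi (x + t *: e))).
    apply/funext => h /=; congr (_ *: (phi _ - _)).
    by rewrite [h *: 1]mulr1 scalerDl addrCA.
  split; first rewrite /derivable E.
    by apply: diff_derivable; exact: smooth_differentiable.
  by rewrite /partial1of2 derive1E /partial /derive E.
have Fcst t : `|t| < 1 -> \int[mu]_(x in D) f t x = \int[mu]_x phi x.
  move=> t1; rewrite Rintegral_mkcond (_ : (f t) \_ D = f t); last first.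
    apply/funext => x; rewrite patchE; case: ifPn => //; rewrite notin_setE => NDx.
    rewrite /f notin_support_eq0// => Sx; apply: NDx; exact: SD t1 Sx.
  rewrite /Rintegral; congr fine.
  have := integral_affine_map (t *: e) setT (EFin \o phi) (unitmx1 R n).
  rewrite det1 normr1 mul1e => E.
  transitivity (\int[mu]_(x in affine_map (t *: e) 1%:M @` setT) (EFin \o phi) x)%E.
    rewrite E; apply: eq_integral => x _.
    by rewrite /f /affine_map mul1mx addrC.
  congr (integral _ _ _); apply/seteqP; split => // x _.
  by rewrite image_affine_map ?unitmx1.
have d0 : `](-1), 1[%classic (0 : R) by rewrite /= in_itv/= ltrN10 ltr01.
have dF := @differentiation_under_integral R _ _ mu f D mD 0 (-1) 1 d0
  (fun t _ => intf t) (fun t x _ _ => (df t x).1) (cst `|M|)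
  (fun _ => normr_ge0 M).
(* The derivative vanishes off the support, which lies in both [O] and [D]. *)
have -> : \int[mu]_(x in O) partial i phi x =
    \int[mu]_(x in D) partial1of2 f 0 x.
  rewrite [LHS]Rintegral_mkcond [RHS]Rintegral_mkcond; apply: eq_Rintegral => x _.
  rewrite !patchE (df _ _).2 scale0r addr0.
  case: ifPn; case: ifPn => //; rewrite notin_setE => h1 h2.
    apply: partial_eq0 => Sx; apply: h1; apply: (SD 0); rewrite ?normr0//.
    by rewrite scale0r addr0.
  by apply/esym/partial_eq0 => /Ophi.
rewrite -dF; last 2 first.
- apply: measurable_bounded_integrable => //; exists `|M|.
  by split => [|r /ltW Mr x _]; [exact: num_real|rewrite /= normr_id].
- move=> t x _ _; rewrite (df _ _).2 /=; exact: le_trans (HM _) (ler_norm _).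
rewrite derive1E (@near_eq_derive _ _ _ _ (cst (\int[mu]_x phi x))) ?derive_cst//.
have := @nbhsx_ballx _ _ (0 : R) 1 ltr01.
apply: filterS => t; rewrite /ball/= sub0r normrN; exact: Fcst.
Qed.

End test_functions.

(** * L^2 and H^1 under affine maps *)

Lemma sqrte_lty (R : realType) (x : \bar R) : (sqrte x < +oo)%E = (x < +oo)%E.
Proof. by case: x => //= [r|]; rewrite !ltey. Qed.

Section sobolev.
Context {R : realType} {n : nat}.
Implicit Types (O A : set 'cV[R]_n) (u v : 'cV[R]_n -> R) (B : 'M[R]_n).
Implicit Types (c : 'cV[R]_n) (g : 'cV[R]_n -> 'cV[R]_n).
Local Notation mu := (@lebesgue_cV R n).

Lemma L2norm_sqr O v : (L2norm O v ^+ 2 = \int[mu]_(x in O) (`|v x| ^+ 2)%:E)%E.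
Proof.
by rewrite /L2norm sqr_sqrte// integral_ge0// => x _; rewrite lee_fin sqr_ge0.
Qed.

Lemma isL2P O v : isL2 O v <->
  measurable_fun O v /\ (\int[mu]_(x in O) (`|v x| ^+ 2)%:E < +oo)%E.
Proof. by rewrite /isL2 /L2norm sqrte_lty. Qed.

Let measurable_sqr O v : measurable_fun O v ->
  measurable_fun O (fun x => (`|v x| ^+ 2)%:E).
Proof.
move=> mv; apply/measurable_EFinP; apply: measurable_funX.
exact: measurableT_comp.
Qed.

Let normr_sqr_ge0 O v x : O x -> (0 <= (`|v x| ^+ 2)%:E)%E.
Proof. by rewrite lee_fin sqr_ge0. Qed.

Lemma isL2Z O v (a : R) : measurable O -> isL2 O v -> isL2 O (fun x => a * v x).
Proof.
move=> mO /isL2P[mv voo]; apply/isL2P; split; first exact: measurable_funM.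
under eq_integral do rewrite normrM exprMn EFinM.
rewrite (ge0_integralZl_EFin mu mO (normr_sqr_ge0 v) (measurable_sqr mv))//.
by apply: lte_mul_pinfty => //; rewrite lee_fin sqr_ge0.
Qed.

Lemma integral_sqr_normD_le O u v : measurable O -> measurable_fun O u ->
  measurable_fun O v ->
  (\int[mu]_(x in O) (`|(u x + v x)%R| ^+ 2)%:E <=
   2%:E * \int[mu]_(x in O) (`|u x| ^+ 2)%:E +
   2%:E * \int[mu]_(x in O) (`|v x| ^+ 2)%:E)%E.
Proof.
move=> mO mu_ mv.
have mu2 := measurable_sqr mu_; have mv2 := measurable_sqr mv.
rewrite -(ge0_integralZl_EFin mu mO (normr_sqr_ge0 u) mu2)//.
rewrite -(ge0_integralZl_EFin mu mO (normr_sqr_ge0 v) mv2)//.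
have sqr2_ge0 (w : 'cV[R]_n -> R) x : O x -> (0 <= 2%:E * (`|w x| ^+ 2)%:E)%E.
  by move=> _; rewrite mule_ge0// lee_fin.
rewrite -(ge0_integralD mu mO (sqr2_ge0 u) (measurable_funeM _ mu2)
  (sqr2_ge0 v) (measurable_funeM _ mv2)).
apply: ge0_le_lower_integral => x _; first by rewrite lee_fin sqr_ge0.
rewrite -!EFinM -EFinD lee_fin !real_normK ?num_real//.
have := sqr_ge0 (u x - v x); nra.
Qed.

Lemma isL2D O u v : measurable O -> isL2 O u -> isL2 O v ->
  isL2 O (fun x => u x + v x).
Proof.
move=> mO /isL2P[mu_ uoo] /isL2P[mv voo]; apply/isL2P; split.
  exact: measurable_funD.
apply: le_lt_trans (integral_sqr_normD_le mO mu_ mv) _.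
by apply: lte_add_pinfty; exact: lte_mul_pinfty.
Qed.

Lemma isL2_cst O (a : R) : measurable O -> (mu O < +oo)%E -> isL2 O (cst a).
Proof.
move=> mO Ooo; apply/isL2P; split=> //=.
by rewrite integral_cst//; apply: lte_mul_pinfty => //; rewrite lee_fin sqr_ge0.
Qed.

Lemma isL2_sum O (I : Type) (r : seq I) (F : I -> 'cV[R]_n -> R) :
  measurable O -> (mu O < +oo)%E ->
  (forall i, isL2 O (F i)) -> isL2 O (fun x => \sum_(i <- r) F i x).
Proof.
move=> mO Ooo LF; elim: r => [|i r IH].
  by under eq_fun do rewrite big_nil; exact: isL2_cst.
by under eq_fun do rewrite big_cons; exact: isL2D.
Qed.

(** [|u psi| <= M (1 + |u|^2)], and constants are integrable on a set of finite measure. This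
    justifies linearity of the integrals in the weak gradient identity. *)
Lemma isL2_integrableM O u (psi : 'cV[R]_n -> R) (M : R) : measurable O ->
  (mu O < +oo)%E -> isL2 O u -> measurable_fun O psi ->
  (forall x, `|psi x| <= M) -> mu.-integrable O (EFin \o (fun x => u x * psi x)).
Proof.
move=> mO Ooo /isL2P[mu_ uoo] mpsi psiM.
apply: (@le_integrable _ _ _ mu O mO _ (EFin \o (fun x => M * (1 + `|u x| ^+ 2)))).
- by apply/measurable_EFinP; exact: measurable_funM.
- move=> x _; rewrite /= lee_fin normrM.
  have M0 := le_trans (normr_ge0 _) (psiM x).
  rewrite [leRHS]ger0_norm ?mulr_ge0 ?addr_ge0// mulrC ler_pM//.
  have := sqr_ge0 (`|u x| - 1); have := normr_ge0 (u x); nra.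
- rewrite (_ : _ \o _ = fun x => (M%:E * ((1 + `|u x| ^+ 2)%R)%:E)%E)//.
  apply: integrableZl => //.
  rewrite (_ : (fun x => _) = (cst 1%:E \+ (fun x => (`|u x| ^+ 2)%:E))%E)//.
  apply: integrableD => //.
    apply: measurable_bounded_integrable => //; exists 1.
    by split => [|r /ltW r1 x _]; [exact: num_real|rewrite /= normr1].
  apply/integrableP; split; first exact: measurable_sqr.
  by under eq_integral do rewrite gee0_abs ?lee_fin ?sqr_ge0//.
Qed.

Lemma isL2_integrable O u : measurable O -> (mu O < +oo)%E -> isL2 O u ->
  mu.-integrable O (EFin \o u).
Proof.
move=> mO Ooo Lu.
have c1 (x : 'cV[R]_n) : `|cst 1 x| <= 1 :> R by rewrite normr1.
have := isL2_integrableM mO Ooo Lu (measurable_cst _) c1.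
by rewrite (_ : (fun x => u x * cst 1 x) = u)//; apply/funext => x; rewrite mulr1.
Qed.

Lemma L2norm_sqr_affine_map c B A v : B \in unitmx ->
  (L2norm (affine_map c B @` A) v ^+ 2 =
   `|\det B|%:E * L2norm A (v \o affine_map c B) ^+ 2)%E.
Proof.
by move=> uB; rewrite !L2norm_sqr ge0_integral_affine_map.
Qed.

Lemma measurable_fun_comp_affine_map c B A v : measurable A -> B \in unitmx ->
  measurable_fun (affine_map c B @` A) v ->
  measurable_fun A (v \o affine_map c B).
Proof.
move=> mA uB mv.
apply: (measurable_comp (measurable_image_affine_map c uB mA) _ mv) => //.
by apply: measurable_funTS; exact: measurable_affine_map.
Qed.

Lemma isL2_affine_map c B A v : measurable A -> B \in unitmx ->
  isL2 (affine_map c B @` A) v -> isL2 A (v \o affine_map c B).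
Proof.
move=> mA uB /isL2P[mv voo]; apply/isL2P; split.
  exact: measurable_fun_comp_affine_map mv.
move: voo; rewrite ge0_integral_affine_map//.
have d0 := normr_det_gt0 uB.
rewrite !ltey; apply: contra => /eqP I.
by rewrite [X in (_ * X)%E]I gt0_muley ?lte_fin.
Qed.

(** Every test function on [A] is a test function on the image composed with the affine map. The
    chain rule writes its [i]-th derivative with the coefficients [B j i]; applying the identity for
    [g] termwise assembles row [i] of [B^T *m g]. *)
Lemma isH1_affine_map c B A v g : measurable A -> (mu A < +oo)%E ->
  B \in unitmx -> isH1 (affine_map c B @` A) v g ->
  isH1 A (v \o affine_map c B) (fun x => B^T *m g (affine_map c B x)).
Proof.
move=> mA Aoo uB [Lv Lg wg].
have LvF := isL2_affine_map mA uB Lv.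
have LgF i := isL2_affine_map mA uB (Lg i).
split => // [i|i phih tphi].
  under eq_fun do rewrite mxE; apply: isL2_sum => // j.
  exact: (isL2Z (B^T i j) mA (LgF j)).
set G := affine_map c B; set GV := affine_map (- invmx B *m c) (invmx B).
pose phi := phih \o GV.
have tphi' : test_fun (G @` A) phi by exact: test_fun_affine_map.
have phiG : phih = phi \o G by apply/funext => x; rewrite /phi /GV /G /= affine_mapK.
have Iaff (h : 'cV[R]_n -> R) : \int[mu]_(x in A) h (G x) =
    `|\det B|^-1 * \int[mu]_(x in G @` A) h x.
  rewrite /Rintegral integral_affine_map//.
  have d0 := normr_det_gt0 uB.
  (* For infinite [y] both sides are [0], since [fine] maps both infinities to [0]. *)
  have -> (y : \bar R) : fine (`|\det B|%:E * y)%E = `|\det B| * fine y.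
    case: y => [y||]//=; first by rewrite mulr0 gt0_muley ?lte_fin.
    by rewrite mulr0 gt0_muleNy ?lte_fin.
  by rewrite mulrA mulVf ?mul1r// gt_eqF.
have intM (u psi : 'cV[R]_n -> R) : isL2 A (u \o G) -> test_fun (G @` A) psi ->
    mu.-integrable A (EFin \o (fun x => u (G x) * psi (G x))).
  move=> Lu tpsi; have [M psiM] := test_fun_bounded tpsi.
  apply: (isL2_integrableM (M := M)) => //.
    apply: measurable_funTS; apply: measurableT_comp; last exact: measurable_affine_map.
    exact: (continuous_measurable_cV (test_fun_continuous tpsi)).
have Rsum (F : 'I_n -> 'cV[R]_n -> R) :
    (forall j, mu.-integrable A (EFin \o F j)) ->
    \int[mu]_(x in A) (\sum_j F j x) = \sum_j \int[mu]_(x in A) F j x.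
  move=> iF; rewrite /Rintegral.
  under eq_integral do rewrite -sumEFin.
  by rewrite integral_sum// sum_fine// => j _; exact: (integrable_fin_num mA (iF j)).
have iZ (a : R) (F : 'cV[R]_n -> R) : mu.-integrable A (EFin \o F) ->
    mu.-integrable A (EFin \o (fun x => a * F x)).
  by move=> iF; exact: (integrableZl mA a iF).
transitivity (\sum_j \int[mu]_(x in A) (B j i * (v (G x) * partial j phi (G x)))).
  rewrite -Rsum => [|j]; last by apply: iZ; apply: intM => //; exact: test_fun_partial.
  apply: eq_Rintegral => x _; rewrite phiG partial_comp_affine_map; last first.
    by case: tphi' => sphi _ _; exact: smooth_differentiable.
  by rewrite fct_sumE mulr_sumr; apply: eq_bigr => j _; rewrite mulrCA.
transitivity (\sum_j - \int[mu]_(x in A) (B j i * (g (G x) j 0 * phi (G x)))).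
  apply: eq_bigr => j _; rewrite !RintegralZl//; last 2 first.
  - exact: intM (LgF j) tphi'.
  - by apply: intM => //; exact: test_fun_partial.
  rewrite (Iaff (fun x => v x * partial j phi x)) wg//.
  by rewrite (Iaff (fun x => g x j 0 * phi x)) !mulrN.
rewrite sumrN -Rsum => [|j]; last by apply: iZ; exact: intM (LgF j) tphi'.
congr (- _); apply: eq_Rintegral => x _.
rewrite phiG mxE mulr_suml; apply: eq_bigr => j _.
by rewrite mxE mulrA.
Qed.

Lemma H1seminorm_affine_map_le c B A g : measurable A -> B \in unitmx ->
  (H1seminorm A (fun x => B^T *m g (affine_map c B x)) ^+ 2 <=
   (`|\det B|^-1 * opnorm B ^+ 2)%:E *
     H1seminorm (affine_map c B @` A) g ^+ 2)%E.
Proof.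
move=> mA uB; rewrite /H1seminorm L2norm_sqr_affine_map// !L2norm_sqr/=.
rewrite muleA -EFinM mulrAC mulVf ?mul1r ?gt_eqF ?normr_det_gt0//.
(* For an invertible [B] this happens only in dimension zero; the left-hand side is then [0]. *)
have [B0|B0] := eqVneq (opnorm B) 0.
  rewrite B0 expr0n mul0e integral0_eq// => x _; congr EFin.
  apply/eqP; rewrite sqrf_eq0 normr_eq0 -[_ == 0]orbF.
  rewrite eq_le enorm_ge0 andbT orbF (le_trans (le_opnorm_tr _ _))//.
  by rewrite B0 mul0r.
rewrite -ge0_lower_integralZl; last 2 first.
- by rewrite exprn_even_gt0.
- by move=> x _; rewrite lee_fin sqr_ge0.
apply: ge0_le_lower_integral => x _; first by rewrite lee_fin sqr_ge0.
rewrite -EFinM lee_fin -exprMn ler_sqr ?nnegrE ?mulr_ge0 ?opnorm_ge0//.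
by rewrite !ger0_norm ?enorm_ge0// le_opnorm_tr.
Qed.

(** Partial derivatives of test functions integrate to zero over [O], so the constant contributes
    nothing to the weak gradient identity. *)
Lemma isH1_addr_cst O v g (a : R) : measurable O -> (mu O < +oo)%E ->
  isH1 O v g -> isH1 O (fun x => v x + a) g.
Proof.
move=> mO Ooo [Lv Lg wg]; split => // [|i phi tphi].
  by apply: isL2D => //; exact: isL2_cst.
have tphi' := test_fun_partial i tphi.
have [M HM] := test_fun_bounded tphi'.
have mphi : measurable_fun O (partial i phi).
  apply: measurable_funTS.
  exact: (continuous_measurable_cV (test_fun_continuous tphi')).
under eq_Rintegral do rewrite mulrDl.
rewrite RintegralD//; last 2 first.
- exact: isL2_integrableM Lv mphi HM.
- exact: isL2_integrableM (isL2_cst a mO Ooo) mphi HM.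
rewrite wg// RintegralZl//; last first.
  have := isL2_integrableM mO Ooo (isL2_cst 1 mO Ooo) mphi HM.
  by under eq_fun do rewrite mul1r.
by rewrite (integral_partial_test_fun i mO tphi) mulr0 addr0.
Qed.

End sobolev.

(** * The fractional seminorms under affine maps *)

Section fractional_affine.
Context {R : realType} {n : nat}.
Implicit Types (O A : set 'cV[R]_n) (u v : 'cV[R]_n -> R) (B : 'M[R]_n).
Implicit Types (c : 'cV[R]_n) (s t : R).
Local Notation mu := (@lebesgue_cV R n).

Definition SSkernel s v (x y : 'cV[R]_n) : \bar R :=
  (`|v x - v y| ^+ 2 / enorm (x - y) `^ (n%:R + 2 * s))%:E.

Lemma SSkernel_ge0 s v x y : (0 <= SSkernel s v x y)%E.
Proof. by rewrite lee_fin divr_ge0 ?sqr_ge0 ?powR_ge0. Qed.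

Lemma SSseminorm_sqr s O v :
  (SSseminorm s O v ^+ 2 =
   \int[mu]_(y in O) \int[mu]_(x in O) SSkernel s v x y)%E.
Proof.
rewrite /SSseminorm sqr_sqrte// integral_ge0// => y _.
by apply: integral_ge0 => x _; exact: SSkernel_ge0.
Qed.

(** Both integrations change variables, hence the square of the determinant; the exponent of the
    kernel passes to [opnorm (invmx B)]. *)
Lemma SSseminorm_affine_map_le s c B A v : 0 < s -> B \in unitmx ->
  (SSseminorm s (affine_map c B @` A) v ^+ 2 <=
   (`|\det B| ^+ 2 * opnorm (invmx B) `^ (n%:R + 2 * s))%:E *
     SSseminorm s A (v \o affine_map c B) ^+ 2)%E.
Proof.
move=> s0 uB; set p := n%:R + 2 * s; set L := opnorm (invmx B).
have p0 : 0 < p by rewrite /p ltr_wpDl// mulr_gt0.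
have d0 := normr_det_gt0 uB.
have Lp0 : 0 <= L `^ p by exact: powR_ge0.
have kern x y : (SSkernel s v (affine_map c B x) (affine_map c B y) <=
    (L `^ p)%:E * SSkernel s (v \o affine_map c B) x y)%E.
  rewrite /SSkernel affine_mapB -EFinM lee_fin /= mulrCA.
  apply: ler_wpM2l; first exact: sqr_ge0.
  (* On the diagonal both inverses are [0]: the power [p] is nonzero, so [0] to the power [p] is
     [0], and [0^-1 = 0]. *)
  have [->|xy] := eqVneq x y.
    by rewrite !subrr mulmx0 enorm0 powR0 ?gt_eqF// invr0 mulr0.
  have xy0 : 0 < enorm (x - y).
    by rewrite lt_neqAle eq_sym enorm_eq0 subr_eq0 xy enorm_ge0.
  have xyL : enorm (x - y) <= L * enorm (B *m (x - y)).
    by rewrite -{1}[x - y](mulKmx uB) le_opnorm.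
  have Bxy0 : 0 < enorm (B *m (x - y)).
    rewrite lt_neqAle eq_sym enorm_eq0 enorm_ge0 andbT.
    apply: contra_neq xy => Bxy; apply/eqP; rewrite -subr_eq0.
    by rewrite -[x - y](mulKmx uB) Bxy mulmx0.
  rewrite ler_pdivlMr ?powR_gt0// mulrC ler_pdivrMr ?powR_gt0//.
  rewrite -powRM ?opnorm_ge0 ?enorm_ge0//.
  by apply: ge0_ler_powR; rewrite ?nnegrE ?(ltW p0) ?mulr_ge0 ?opnorm_ge0 ?enorm_ge0.
have I0 s' v' A' y : (0 <= \int[mu]_(x in A') SSkernel s' v' x y)%E.
  by apply: integral_ge0 => x _; exact: SSkernel_ge0.
set F := affine_map c B in kern *.
pose J y := (\int[mu]_(x in F @` A) SSkernel s v x y)%E.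
have outer : (\int[mu]_(y in F @` A) J y =
    `|\det B|%:E * \int[mu]_(y in A) J (F y))%E.
  exact: (ge0_integral_affine_map uB (fun y _ => I0 s v _ y)).
have inner y : (J (F y) =
    `|\det B|%:E * \int[mu]_(x in A) SSkernel s v (F x) (F y))%E.
  exact: (ge0_integral_affine_map uB (fun x _ => SSkernel_ge0 s v x (F y))).
rewrite [leLHS](SSseminorm_sqr s (F @` A) v).
rewrite [X in (_ <= _ * X)%E](SSseminorm_sqr s A (v \o F)).
rewrite [leLHS]outer.
rewrite expr2 -[(_ * _ * _)%R]mulrA [X in (_ <= X * _)%E]EFinM -[leRHS]muleA.
apply: lee_wpmul2l; first by rewrite lee_fin ltW.
pose I y := (\int[mu]_(x in A) SSkernel s (v \o F) x y)%E.
apply: (@le_trans _ _ (\int[mu]_(y in A) ((`|\det B| * L `^ p)%:E * I y))%E).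
  apply: ge0_le_lower_integral => y _; first exact: I0.
  rewrite inner EFinM -muleA; apply: lee_wpmul2l; first by rewrite lee_fin ltW.
  apply: (@le_trans _ _ (\int[mu]_(x in A) ((L `^ p)%:E *
      SSkernel s (v \o F) x y))%E).
    by apply: ge0_le_lower_integral => x _; [exact: SSkernel_ge0|exact: kern].
  by apply: ge0_lower_integralZl_le => // x _; exact: SSkernel_ge0.
apply: ge0_lower_integralZl_le; first by rewrite mulr_ge0.
by move=> y _; exact: I0.
Qed.

Lemma SSseminorm_addr_cst s O v (a : R) :
  SSseminorm s O (fun x => v x + a) = SSseminorm s O v.
Proof.
rewrite /SSseminorm; under eq_integral => y _ do
  (under eq_integral => x _ do rewrite opprD addrACA subrr addr0).
by [].
Qed.

Lemma interp_of_K_sqr s (K : R -> \bar R) : (forall t, 0 <= K t)%E ->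
  (interp_of_K s K ^+ 2 = \int[lebesgue_measure]_(t in `]0%R, +oo[)
    ((t `^ (- (2 * s)))%:E * K t * (t^-1)%:E))%E.
Proof.
move=> K0; rewrite /interp_of_K sqr_sqrte// integral_ge0// => t /=.
rewrite in_itv/= andbT => t0.
by rewrite !mule_ge0// lee_fin ?powR_ge0// invr_ge0 ltW.
Qed.

(** The infimum of this set is the square of the quadratic K-functional of [v] at [t], taken with
    the gradient seminorm. *)
Definition Kseminorm_set O v t : set (\bar R) :=
  [set y | exists v0 v1 g,
    [/\ isL2 O v0, isH1 O v1 g, forall x, O x -> v x = v0 x + v1 x &
      y = (L2norm O v0 ^+ 2 + (t ^+ 2)%:E * H1seminorm O g ^+ 2)%E]].

Definition Knorm_set O v t : set (\bar R) :=
  [set y | exists v0 v1 g,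
    [/\ isL2 O v0, isH1 O v1 g, forall x, O x -> v x = v0 x + v1 x &
      y = (L2norm O v0 ^+ 2 + (t ^+ 2)%:E * H1norm O v1 g ^+ 2)%E]].

Lemma L2norm_ge0 O v : (0 <= L2norm O v)%E.
Proof. exact: sqrte_ge0. Qed.

Lemma Kseminorm_ge0 O v t : (0 <= ereal_inf (Kseminorm_set O v t))%E.
Proof.
apply: le_ereal_inf_tmp => _ [v0 [v1 [g [_ _ _ ->]]]].
by rewrite adde_ge0// ?mule_ge0 ?expe_ge0 ?L2norm_ge0// lee_fin sqr_ge0.
Qed.

Lemma Knorm_ge0 O v t : (0 <= ereal_inf (Knorm_set O v t))%E.
Proof.
apply: le_ereal_inf_tmp => _ [v0 [v1 [g [_ _ _ ->]]]].
by rewrite adde_ge0// ?mule_ge0 ?expe_ge0 ?sqrte_ge0// lee_fin sqr_ge0.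
Qed.

Lemma interp_seminorm_sqr s O v :
  (interp_seminorm s O v ^+ 2 = \int[lebesgue_measure]_(t in `]0%R, +oo[)
    ((t `^ (- (2 * s)))%:E * ereal_inf (Kseminorm_set O v t) * (t^-1)%:E))%E.
Proof. by rewrite /interp_seminorm interp_of_K_sqr// => t; exact: Kseminorm_ge0. Qed.

Lemma interp_norm_sqr s O v :
  (interp_norm s O v ^+ 2 = \int[lebesgue_measure]_(t in `]0%R, +oo[)
    ((t `^ (- (2 * s)))%:E * ereal_inf (Knorm_set O v t) * (t^-1)%:E))%E.
Proof. by rewrite /interp_norm interp_of_K_sqr// => t; exact: Knorm_ge0. Qed.

(** The constant is absorbed by [v1], whose weak gradient is unchanged; adding [- a] gives the
    converse inclusion. *)
Lemma interp_seminorm_addr_cst s O v (a : R) : measurable O ->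
  (mu O < +oo)%E ->
  interp_seminorm s O (fun x => v x + a) = interp_seminorm s O v.
Proof.
move=> mO Ooo; congr (interp_of_K s _); apply/funext => t; congr ereal_inf.
have sub w b : Kseminorm_set O w t `<=` Kseminorm_set O (fun x => w x + b) t.
  move=> _ [v0 [v1 [g [Lv0 Hv1 wE ->]]]].
  exists v0, (fun x => v1 x + b), g; split => //; first exact: isH1_addr_cst.
  by move=> x Ox; rewrite wE// addrA.
apply/seteqP; split; last exact: sub.
rewrite -[X in _ `<=` X]/(Kseminorm_set O v t).
have := sub (fun x => v x + a) (- a).
by rewrite (_ : (fun x => v x + a - a) = v)//; apply/funext => x; rewrite addrK.
Qed.

Lemma Kseminorm_affine_map_le c B A v t : measurable A -> (mu A < +oo)%E ->
  B \in unitmx ->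
  (ereal_inf (Kseminorm_set A (v \o affine_map c B) t) <= (`|\det B|^-1)%:E *
    ereal_inf (Kseminorm_set (affine_map c B @` A) v (opnorm B * t)))%E.
Proof.
move=> mA Aoo uB; have d0 := normr_det_gt0 uB.
rewrite lee_pdivlMl//; apply: le_ereal_inf_tmp => _ [v0 [v1 [g [Lv0 Hv1 vE ->]]]].
rewrite -lee_pdivlMl//.
apply: (@le_trans _ _ (L2norm A (v0 \o affine_map c B) ^+ 2 + (t ^+ 2)%:E *
    H1seminorm A (fun x => B^T *m g (affine_map c B x))%R ^+ 2)%E).
  apply: ereal_inf_lbound; exists (v0 \o affine_map c B), (v1 \o affine_map c B).
  exists (fun x => B^T *m g (affine_map c B x)); split => //.
  - exact: isL2_affine_map Lv0.
  - exact: isH1_affine_map Hv1.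
  - by move=> x Ax; apply: vE; exists x.
rewrite ge0_muleDr; last 2 first.
- by rewrite expe_ge0 ?L2norm_ge0.
- by rewrite mule_ge0 ?expe_ge0 ?L2norm_ge0// lee_fin sqr_ge0.
apply: leeD.
  rewrite L2norm_sqr_affine_map// muleA -EFinM mulVf ?mul1e// gt_eqF//.
apply: le_trans (lee_wpmul2l _ (H1seminorm_affine_map_le c g mA uB)) _.
  by rewrite lee_fin sqr_ge0.
rewrite !muleA -!EFinM.
have -> : t ^+ 2 * (`|\det B|^-1 * opnorm B ^+ 2) =
    `|\det B|^-1 * (opnorm B * t) ^+ 2 by ring.
by [].
Qed.

(** A measurable [h] below [t -> f (b t)] is rescaled to [t -> h (b^-1 t)], which lies below [f]. *)
Let lower_integral_scale_le (b : R) (f : R -> \bar R) : 0 < b ->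
  (forall t, 0 <= f t)%E ->
  (\int[lebesgue_measure]_t f (b * t)%R <=
   (b^-1)%:E * \int[lebesgue_measure]_t f t)%E.
Proof.
move=> b0 f0; have bV0 : b^-1 != 0 by rewrite invr_eq0 gt_eqF.
apply: ge0_integral_le_ub => // h mh h0 hf.
rewrite (@ge0_integral_affine _ b^-1 0 (EFin \o h))//; last first.
  exact/measurable_EFinP.
rewrite gtr0_norm ?invr_gt0//; apply: lee_wpmul2l.
  by rewrite lee_fin invr_ge0 ltW.
apply: ge0_le_lower_integral => t _; first by rewrite lee_fin.
by rewrite /= addr0 (le_trans (hf _))// mulrA divff ?mul1r ?gt_eqF.
Qed.

Lemma interp_seminorm_affine_map_le s c B A v : (0 < n)%N -> measurable A ->
  (mu A < +oo)%E -> B \in unitmx ->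
  (interp_seminorm s A (v \o affine_map c B) ^+ 2 <=
   (`|\det B|^-1 * opnorm B `^ (2 * s))%:E *
     interp_seminorm s (affine_map c B @` A) v ^+ 2)%E.
Proof.
move=> n0 mA Aoo uB; have d0 := normr_det_gt0 uB.
have b0 := opnorm_gt0 n0 uB; set b := opnorm B in b0 *.
rewrite [leLHS](interp_seminorm_sqr s A (v \o affine_map c B)).
rewrite [X in (_ <= _ * X)%E](interp_seminorm_sqr s (affine_map c B @` A) v).
pose H := fun t => ((t `^ (- (2 * s)))%:E *
  ereal_inf (Kseminorm_set (affine_map c B @` A) v t) * (t^-1)%:E)%E.
have H0 t : (0 < t) -> (0 <= H t)%E.
  move=> t0; rewrite !mule_ge0 ?Kseminorm_ge0// lee_fin ?powR_ge0//.
  by rewrite invr_ge0 ltW.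
pose HT := H \_ `]0%R, +oo[.
have HT0 t : (0 <= HT t)%E.
  by apply: erestrict_ge0 => r /=; rewrite in_itv/= andbT => /H0.
(* In the variable [b t] the weight [t^(-2s) t^-1] is [b^(2s) b] times the weight at [b t]; the
   extra factor [b] cancels the [b^-1] of the substitution. *)
apply: (@le_trans _ _ (\int[lebesgue_measure]_t
    ((`|\det B|^-1 * b `^ (2 * s) * b)%:E * HT (b * t)%R))%E).
  rewrite integral_mkcond; apply: ge0_le_lower_integral => t _.
    apply: erestrict_ge0 => {}t /=; rewrite in_itv/= andbT => t0.
    rewrite !mule_ge0 ?Kseminorm_ge0// lee_fin ?powR_ge0//.
    by rewrite invr_ge0 ltW.
  rewrite /HT !patchE !mem_setE !in_itv/= !andbT pmulr_rgt0//.
  case: ifPn => t0; last by rewrite mule0.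
  rewrite /H [leRHS](_ : _ = (t `^ (- (2 * s)))%:E * ((`|\det B|^-1)%:E *
    ereal_inf (Kseminorm_set (affine_map c B @` A) v (b * t))) * (t^-1)%:E)%E.
    apply: lee_wpmul2r; first by rewrite lee_fin invr_ge0 ltW.
    apply: lee_wpmul2l; first by rewrite lee_fin powR_ge0.
    exact: Kseminorm_affine_map_le.
  set k := ereal_inf _.
  rewrite -muleA (muleC k) !muleA -!EFinM; rewrite [RHS]muleAC -!EFinM.
  congr ((_)%:E * _)%E.
  rewrite powRM ?(ltW b0) ?(ltW t0)// powRN -/(powR _ _).
  have bs : b `^ (2 * s) != 0 by rewrite gt_eqF// powR_gt0.
  by field; rewrite bs !gt_eqF.
rewrite ge0_lower_integralZl//; last first.
  by rewrite !mulr_gt0// ?invr_gt0// powR_gt0.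
rewrite [X in (_ <= _ * X)%E]integral_mkcond -/HT.
rewrite [leRHS](_ : _ = ((`|\det B|^-1 * b `^ (2 * s) * b)%:E *
   ((b^-1)%:E * \int[lebesgue_measure]_t HT t))%E); last first.
  by rewrite muleA -EFinM mulfK ?gt_eqF.
apply: lee_wpmul2l; last exact: lower_integral_scale_le.
by rewrite lee_fin !mulr_ge0 ?invr_ge0 ?powR_ge0// ltW.
Qed.

End fractional_affine.

(** * Comparison of norms and seminorms *)

Section power_integrals.
Context {R : realType}.
Local Notation leb := (@lebesgue_measure R).

Lemma integral_itv_powR (a b q : R) : 0 < a -> a < b -> q != 0 ->
  (\int[leb]_(t in `[a, b]) (t `^ (q - 1))%:E = ((b `^ q - a `^ q) / q)%:E)%E.
Proof.
move=> a0 ab q0; pose F (t : R) := q^-1 * t `^ q.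
have dF (t : R) : 0 < t -> is_derive t 1 F (t `^ (q - 1)).
  move=> t0; rewrite /F.
  have H := is_derive1_powR q t0.
  have := is_deriveZ q^-1 H.
  by rewrite [_ *: _]mulrA mulVf// mul1r.
have cF (t : R) : 0 < t -> {for t, continuous F}.
  move=> t0; apply: differentiable_continuous; apply/derivable1_diffP.
  by have [] := dF _ t0.
have b0 := lt_trans a0 ab.
rewrite (@continuous_FTC2 R _ F)//.
- by rewrite /F -EFinB; congr EFin; field.
- apply: derivable_within_continuous => t; rewrite in_itv/= => /andP[at_ _].
  by apply: derivable_powR; rewrite in_itv/= andbT (lt_le_trans a0).
- split.
  + move=> t; rewrite in_itv/= => /andP[at_ _].
    by have [] := dF _ (lt_trans a0 at_).
  + by apply: cvg_at_right_filter; exact: cF.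
  + by apply: cvg_at_left_filter; exact: cF.
- move=> t; rewrite in_itv/= => /andP[at_ _]; rewrite derive1E.
  by have [] := dF _ (lt_trans a0 at_).
Qed.

(** Monotone convergence along an exhaustion; it carries bounds on compact intervals over to the
    improper integrals of powers. *)
Lemma ge0_integral_nd_bigcup_le (F : (set (measurableTypeR R))^nat)
    (f : measurableTypeR R -> \bar R) (M : \bar R) :
  nondecreasing_seq F -> (forall i, measurable (F i)) ->
  (forall i, measurable_fun (F i) f) -> (forall i x, F i x -> 0 <= f x)%E ->
  (forall i, \int[leb]_(x in F i) f x <= M)%E ->
  (\int[leb]_(x in \bigcup_i F i) f x <= M)%E.
Proof.
move=> nF mF mf f0 FM.
have cF := @ge0_nondecreasing_set_cvg_integral _ _ R F f lebesgue_measure nF mF mf f0.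
rewrite -(cvg_lim _ cF)//; apply: lime_le; first by apply/cvg_ex; eexists; exact: cF.
exact: nearW.
Qed.

Lemma integral_powR01_le (q : R) : 0 < q ->
  (\int[leb]_(t in `]0%R, 1%R]) (t `^ (q - 1))%:E <= (q^-1)%:E)%E.
Proof.
move=> q0.
(* Starting at [2] keeps every interval nondegenerate, as [integral_itv_powR] requires. *)
have -> : `]0, 1]%classic = \bigcup_k `[k.+2%:R^-1, 1]%classic :> set R.
  apply/seteqP; split => t /=.
    rewrite in_itv/= => /andP[t0 t1]; exists (Num.truncn t^-1) => //=.
    rewrite in_itv/= t1 andbT -[leRHS]invrK lef_pV2 ?posrE ?invr_gt0//.
    by rewrite (le_trans (ltW (Num.Theory.truncnS_gt _)))// ler_nat.
  by move=> [k _] /=; rewrite !in_itv/= => /andP[kt ->]; rewrite (lt_le_trans _ kt).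
apply: ge0_integral_nd_bigcup_le => //.
- apply/nondecreasing_seqP => k; apply/subsetPset => t /=.
  rewrite !in_itv/= => /andP[kt ->]; rewrite andbT (le_trans _ kt)//.
  by rewrite lef_pV2 ?posrE// ler_nat.
- by move=> k; apply/measurable_EFinP; apply: measurable_funTS; exact: measurable_powR.
- by move=> k t _; rewrite lee_fin powR_ge0.
move=> k; rewrite integral_itv_powR ?gt_eqF// ?invf_lt1// ?ltr1n//.
by rewrite lee_fin powR1 ler_piMl ?invr_ge0 ?ltW// lerBlDr lerDl powR_ge0.
Qed.

Lemma integral_powR1y_le (q : R) : 0 < q ->
  (\int[leb]_(t in `[1%R, +oo[) (t `^ (- q - 1))%:E <= (q^-1)%:E)%E.
Proof.
move=> q0.
have -> : `[1, +oo[%classic = \bigcup_k `[1, k.+2%:R]%classic :> set R.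
  apply/seteqP; split => t /=.
    rewrite in_itv/= andbT => t1; exists (Num.truncn t) => //=.
    by rewrite in_itv/= t1 (le_trans (ltW (Num.Theory.truncnS_gt _)))// ler_nat.
  by move=> [k _] /=; rewrite !in_itv/= => /andP[->].
apply: ge0_integral_nd_bigcup_le => //.
- apply/nondecreasing_seqP => k; apply/subsetPset => t /=.
  by rewrite !in_itv/= => /andP[-> kt]; rewrite (le_trans kt)// ler_nat.
- by move=> k; apply/measurable_EFinP; apply: measurable_funTS; exact: measurable_powR.
- by move=> k t _; rewrite lee_fin powR_ge0.
move=> k; rewrite integral_itv_powR ?oppr_eq0 ?gt_eqF// ?ltr1n//.
rewrite lee_fin powR1 invrN mulrN -mulNr opprB.
by rewrite ler_piMl ?invr_ge0 ?ltW// lerBlDr lerDl powR_ge0.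
Qed.

End power_integrals.

Section norm_comparison.
Context {R : realType} {n : nat}.
Implicit Types (O : set 'cV[R]_n) (w : 'cV[R]_n -> R).
Local Notation mu := (@lebesgue_cV R n).
Local Notation leb := (@lebesgue_measure R).

Let isH1_0 O : measurable O -> (mu O < +oo)%E -> isH1 O (cst 0) (cst 0).
Proof.
move=> mO Ooo; split; first exact: isL2_cst.
  move=> i; rewrite (_ : (fun x => _) = cst 0); first exact: isL2_cst.
  by apply/funext => x; rewrite mxE.
move=> i phi _; rewrite (_ : (fun x => _) = cst 0); last first.
  by apply/funext => x; rewrite mul0r.
rewrite [X in _ = - X](_ : _ = \int[mu]_(x in O) cst 0 x); last first.
  by apply: eq_Rintegral => x _; rewrite mxE mul0r.
by rewrite /Rintegral integral0 oppr0.
Qed.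

Lemma H1norm_sqr O v g :
  (H1norm O v g ^+ 2 = L2norm O v ^+ 2 + H1seminorm O g ^+ 2)%E.
Proof. by rewrite [LHS]sqr_sqrte// adde_ge0 ?expe_ge0 ?L2norm_ge0. Qed.

(* For [t <= 1], an admissible splitting [w = v0 + v1] for the seminorm functional
   is also used for the norm functional, with
   [|v1|^2 <= 2 |v0|^2 + 2 |w|^2]; for [t > 1] take [v0 = w] and [v1 = 0]. *)
Let Knorm_le O w t (N : R) : measurable O -> (mu O < +oo)%E -> isL2 O w ->
  (L2norm O w ^+ 2 = N%:E)%E -> 0 < t ->
  (ereal_inf (Knorm_set O w t) <= 3%:E * ereal_inf (Kseminorm_set O w t) +
    (if (t <= 1)%R then (2 * t ^+ 2 * N)%:E else N%:E))%E.
Proof.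
move=> mO Ooo Lw wN t0.
have N0 : 0 <= N by rewrite -lee_fin -wN expe_ge0 ?L2norm_ge0.
have [t1|t1] := leP t 1; last first.
  apply: (@le_trans _ _ N%:E); last first.
    by rewrite leeDr// mule_ge0 ?Kseminorm_ge0.
  rewrite -wN; apply: ereal_inf_lbound; exists w, (cst 0), (cst 0); split => //.
  - exact: isH1_0.
  - by move=> x _; rewrite addr0.
  rewrite H1norm_sqr /H1seminorm !L2norm_sqr.
  rewrite [X in (_ * (X + _))%E]integral0_eq; last first.
    by move=> x _; rewrite /= normr0 expr0n.
  rewrite [X in (_ * (_ + X))%E]integral0_eq; last first.
    by move=> x _; rewrite /= enorm0 normr0 expr0n.
  by rewrite adde0 mule0 adde0.
rewrite -leeBlDr// -lee_pdivrMl//; apply: le_ereal_inf_tmp.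
move=> _ [v0 [v1 [g [Lv0 Hv1 wE ->]]]].
rewrite lee_pdivrMl// leeBlDr//.
apply: (@le_trans _ _ (L2norm O v0 ^+ 2 + (t ^+ 2)%:E * H1norm O v1 g ^+ 2)%E).
  by apply: ereal_inf_lbound; exists v0, v1, g.
have [Lv1 _ _] := Hv1.
rewrite H1norm_sqr.
set a := (L2norm O v0 ^+ 2)%E; set h := (H1seminorm O g ^+ 2)%E.
have a0 : (0 <= a)%E by rewrite expe_ge0 ?L2norm_ge0.
have h0 : (0 <= h)%E by rewrite expe_ge0 ?L2norm_ge0.
have v1le : (L2norm O v1 ^+ 2 <= 2%:E * a + (2 * N)%:E)%E.
  rewrite EFinM -wN /a !L2norm_sqr.
  have [mw _] := Lw; have [mv0 _] := Lv0.
  have mNv0 : measurable_fun O (fun x => - v0 x) by exact: measurableT_comp.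
  have := integral_sqr_normD_le mO mw mNv0; rewrite addeC.
  under [X in (_ <= _ * X + _)%E -> _]eq_integral do rewrite normrN.
  apply: le_trans; apply: ge0_le_lower_integral => x Ox.
    by rewrite lee_fin sqr_ge0.
  by rewrite wE// addrAC subrr add0r.
have t2 : t ^+ 2 <= 1 by rewrite expr_le1// ltW.
move: v1le; set b := (L2norm O v1 ^+ 2)%E => v1le.
clearbody a h b.
apply: (@le_trans _ _ (a + (t ^+ 2)%:E * (2%:E * a + (2 * N)%:E + h))%E).
  apply: leeD => //; apply: lee_wpmul2l; first by rewrite lee_fin sqr_ge0.
  exact: leeD.
(* Since [t <= 1], the coefficient [1 + 2 t^2] of [a] is at most [3]; the coefficient [t^2] of [h]
   is at most [3 t^2]. *)
rewrite !ge0_muleDr ?adde_ge0 ?mule_ge0 ?lee_fin ?sqr_ge0 ?mulr_ge0//.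
rewrite !muleA -!EFinM [(2 * t ^+ 2 * N)%R](_ : _ = t ^+ 2 * (2 * N)); last by ring.
rewrite addeA addeA addeAC; apply: leeD => //; apply: leeD.
  rewrite -[X in (X + _)%E]mul1e -ge0_muleDl ?lee_fin ?(mulr_ge0 (sqr_ge0 t))//.
  by apply: lee_wpmul2r => //; rewrite lee_fin; lra.
by apply: (lee_wpmul2r h0); rewrite lee_fin; have := sqr_ge0 t; lra.
Qed.

(** Integrate [Knorm_le] against [t^(-2s) dt/t]. With [N] the squared [L^2]-norm, the remainder
    contributes at most [2 N / (2 - 2 s) + N / (2 s)], which falls short of [N / (s (1 - s))] by
    [N / (2 s)]. *)
Lemma interp_norm_sqr_le s O w : 0 < s -> s < 1 -> measurable O ->
  (mu O < +oo)%E -> isL2 O w ->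
  (interp_norm s O w ^+ 2 <= 3%:E * interp_seminorm s O w ^+ 2 +
    ((s * (1 - s))^-1)%:E * L2norm O w ^+ 2)%E.
Proof.
move=> s0 s1 mO Ooo Lw.
have [N wN] : exists N : R, (L2norm O w ^+ 2 = N%:E)%E.
  have [_ woo] := (isL2P O w).1 Lw.
  exists (fine (L2norm O w ^+ 2)); rewrite fineK// L2norm_sqr ge0_fin_numE//.
  by apply: integral_ge0 => x _; rewrite lee_fin sqr_ge0.
have N0 : 0 <= N by rewrite -lee_fin -wN expe_ge0 ?L2norm_ge0.
rewrite [leLHS](interp_norm_sqr s O w).
rewrite [X in (_ <= _ * X + _)%E](interp_seminorm_sqr s O w).
rewrite wN.
pose g1 t : R := 2 * N * t `^ ((2 - 2 * s) - 1).
pose g2 t : R := N * t `^ (- (2 * s) - 1).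
(* A measurable majorant of the weighted remainder, so that the integral of the sum can be split.
   The overlap of the two pieces at [t = 1] only enlarges it. *)
pose G : R -> R := (g1 \_ `]0, 1]%classic) \+ (g2 \_ `[1, +oo[%classic).
have mg1 : measurable_fun setT g1.
  by apply: measurable_funM => //; exact: measurable_powR.
have mg2 : measurable_fun setT g2.
  by apply: measurable_funM => //; exact: measurable_powR.
have g1_ge0 t : 0 <= g1 t by rewrite !mulr_ge0 ?powR_ge0.
have g2_ge0 t : 0 <= g2 t by rewrite !mulr_ge0 ?powR_ge0.
have r1 t : 0 <= (g1 \_ `]0, 1]%classic) t by rewrite patchE; case: ifPn.
have r2 t : 0 <= (g2 \_ `[1, +oo[%classic) t by rewrite patchE; case: ifPn.
have mr1 : measurable_fun setT (g1 \_ `]0, 1]%classic).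
  by apply/(measurable_restrictT _ _).1 => //; exact: measurable_funTS.
have mr2 : measurable_fun setT (g2 \_ `[1, +oo[%classic).
  by apply/(measurable_restrictT _ _).1 => //; exact: measurable_funTS.
have G0 t : 0 <= G t by rewrite addr_ge0.
have gam_ge0 t : (0 <= if (t <= 1)%R then (2 * t ^+ 2 * N)%:E else N%:E)%E.
  by case: ifPn => _; rewrite lee_fin// mulr_ge0// mulr_ge0// sqr_ge0.
have intG : (\int[leb]_t (G t)%:E <= ((s * (1 - s))^-1 * N)%:E)%E.
  under eq_integral do rewrite EFinD.
  rewrite ge0_integralD//=; last 4 first.
  - by move=> t _; rewrite lee_fin.
  - exact/measurable_EFinP.
  - by move=> t _; rewrite lee_fin.
  - exact/measurable_EFinP.
  have patchint (g : R -> R) (D : set R) :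
      (\int[leb]_t ((g \_ D) t)%:E = \int[leb]_(t in D) (g t)%:E)%E.
    rewrite [RHS]integral_mkcond; apply: eq_integral => t _.
    by rewrite !patchE; case: ifPn.
  rewrite !patchint.
  under eq_integral do rewrite EFinM.
  under [X in (_ + X)%E]eq_integral do rewrite EFinM.
  have mpow q (D : set R) : measurable_fun D (fun t : R => (t `^ q)%:E).
    by apply/measurable_EFinP; apply: measurable_funTS; exact: measurable_powR.
  rewrite !ge0_integralZl_EFin//; try by move=> t _; rewrite lee_fin powR_ge0.
  apply: (@le_trans _ _ ((2 * N)%:E * ((2 - 2 * s)^-1)%:E +
      N%:E * ((2 * s)^-1)%:E)%E).
    apply: leeD; apply: lee_wpmul2l; rewrite ?lee_fin ?mulr_ge0//.
      by apply: integral_powR01_le; lra.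
    by apply: integral_powR1y_le; rewrite mulr_gt0.
  rewrite -!EFinM -EFinD lee_fin -subr_ge0.
  have -> : (s * (1 - s))^-1 * N - (2 * N * (2 - 2 * s)^-1 + N * (2 * s)^-1) =
      N * (2 * s)^-1.
    by field; rewrite !gt_eqF//; lra.
  by rewrite mulr_ge0// invr_ge0 mulr_ge0// ltW.
- exact: mpow.
- exact: mpow.
- by rewrite mulr_ge0.
apply: (@le_trans _ _ (\int[leb]_(t in `]0%R, +oo[) (3%:E * ((t `^ (- (2 * s)))%:E *
    ereal_inf (Kseminorm_set O w t) * (t^-1)%:E) + (G t)%:E))%E).
  apply: ge0_le_lower_integral => t /=; rewrite in_itv/= andbT => t0.
    by rewrite !mule_ge0 ?Knorm_ge0// lee_fin ?powR_ge0// invr_ge0 ltW.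
  have tV0 : 0 <= t^-1 by rewrite invr_ge0 ltW.
  apply: le_trans.
    apply: lee_wpmul2r; first by rewrite lee_fin.
    apply: lee_wpmul2l; first by rewrite lee_fin powR_ge0.
    exact: Knorm_le wN t0.
  rewrite ge0_muleDr; last 2 first.
  - by rewrite mule_ge0 ?Kseminorm_ge0.
  - exact: gam_ge0.
  rewrite ge0_muleDl; last 2 first.
  - by rewrite !mule_ge0 ?Kseminorm_ge0// lee_fin powR_ge0.
  - by rewrite mule_ge0 ?gam_ge0// lee_fin powR_ge0.
  apply: leeD; first by rewrite [X in (X * _)%E]muleCA -muleA.
  rewrite /G /=; case: ifPn => [t1|]; last rewrite -ltNge => t1.
    rewrite -!EFinM lee_fin -[leLHS]addr0; apply: lerD => //.
    rewrite patchE mem_set; last by rewrite /= in_itv/= t0 t1.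
    rewrite /g1 (_ : 2 - 2 * s - 1 = - (2 * s) + 2%:R - 1); last by ring.
    rewrite powRD ?(gt_eqF t0) ?implybT// powRD ?(gt_eqF t0) ?implybT//.
    rewrite powR_mulrn ?(ltW t0)// powR_inv1 ?(ltW t0)//.
    by rewrite le_eqVlt; apply/orP; left; apply/eqP; ring.
  rewrite -!EFinM lee_fin -[leLHS]add0r; apply: lerD => //.
  rewrite patchE mem_set; last by rewrite /= in_itv/= andbT ltW.
  rewrite /g2 powRD ?(gt_eqF t0) ?implybT// powR_inv1 ?(ltW t0)//.
  by rewrite le_eqVlt; apply/orP; left; apply/eqP; ring.
apply: le_trans.
  apply: ge0_lower_integralD_le => //.
  - by apply: measurable_funTS; exact: measurable_funD.
  - move=> t /=; rewrite in_itv/= andbT => t0.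
    by rewrite !mule_ge0 ?Kseminorm_ge0// lee_fin ?powR_ge0// invr_ge0 ltW.
apply: leeD.
  apply: ge0_lower_integralZl_le => // t /=; rewrite in_itv/= andbT => t0.
  by rewrite !mule_ge0 ?Kseminorm_ge0// lee_fin ?powR_ge0// invr_ge0 ltW.
apply: le_trans intG; rewrite integral_mkcond.
apply: ge0_le_lower_integral => t _.
  by apply: erestrict_ge0 => {}t _; rewrite lee_fin.
by rewrite patchE; case: ifPn => // _; rewrite lee_fin.
Qed.

End norm_comparison.

(** * Poincare inequality for functions of mean zero, with the Slobodeckij seminorm *)

Section poincare.
Context {R : realType} {n : nat}.
Implicit Types (O : set 'cV[R]_n) (w v : 'cV[R]_n -> R) (s : R).
Local Notation mu := (@lebesgue_cV R n).

Lemma isL2_L2norm_fin O w : isL2 O w ->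
  exists2 N : R, 0 <= N & (L2norm O w ^+ 2 = N%:E)%E.
Proof.
move=> /isL2P[_ woo].
have w0 : (0 <= \int[mu]_(x in O) (`|w x| ^+ 2)%:E)%E.
  by apply: integral_ge0 => x _; rewrite lee_fin sqr_ge0.
exists (fine (L2norm O w ^+ 2)); rewrite L2norm_sqr ?fine_ge0//.
by rewrite fineK// ge0_fin_numE.
Qed.

(** The cross term vanishes because [w] has integral zero; in the application [y] is itself a value
    of [w]. *)
Let integral_sqr_subr O w (N m y : R) : measurable O -> mu O = m%:E ->
  isL2 O w -> (L2norm O w ^+ 2 = N%:E)%E -> (\int[mu]_(x in O) (w x)%:E = 0)%E ->
  (\int[mu]_(x in O) (`|w x - y| ^+ 2)%:E = (N + m * y ^+ 2)%:E)%E.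
Proof.
move=> mO Om Lw wN w0; have Ooo : (mu O < +oo)%E by rewrite Om ltry.
have iw := isL2_integrable mO Ooo Lw.
have ic (a : R) : mu.-integrable O (EFin \o cst a).
  by apply: isL2_integrable => //; exact: isL2_cst.
have iw2 : mu.-integrable O (fun x => (`|w x| ^+ 2)%:E).
  have [mw woo] := (isL2P O w).1 Lw; apply/integrableP; split.
    apply/measurable_EFinP; apply: measurable_funX; exact: measurableT_comp.
  by under eq_integral do rewrite gee0_abs ?lee_fin ?sqr_ge0//.
have iwy : mu.-integrable O (fun x => ((- 2 * y)%:E * (w x)%:E)%E).
  exact: integrableZl.
have E x : ((`|w x - y| ^+ 2)%:E =
    (`|w x| ^+ 2)%:E + ((- 2 * y)%:E * (w x)%:E + (y ^+ 2)%:E))%E.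
  rewrite -EFinM -!EFinD !real_normK ?num_real//; congr EFin; ring.
under eq_integral do rewrite E.
rewrite integralD//; last first.
  by apply: integrableD => //; exact: (ic (y ^+ 2)).
rewrite integralD//; last exact: (ic (y ^+ 2)).
rewrite integralZl// w0 mule0 add0e -L2norm_sqr wN integral_cst//.
by rewrite [X in (_ + _ * X)%E]Om -EFinM -EFinD (mulrC m).
Qed.

Let powR_sqr (a q : R) : (a `^ q) ^+ 2 = a `^ (q * 2).
Proof. by rewrite powRrM powR_mulrn// powR_ge0. Qed.

(** The second entry of the maximum in [C_PF_SS] has square [D^(n + 2 s) / 2], and the volume factor
    has square [1 / m]. *)
Let C_PF_SS_sqr_ge s O (m : R) : 0 < m -> mu O = m%:E ->
  diameter O `^ (n%:R + 2 * s) / (2 * m) <= C_PF_SS s O ^+ 2.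
Proof.
move=> m0 Om; rewrite /C_PF_SS exprMn Om /= powR_sqr mulNr mulVf//.
rewrite powR_inv1 ?(ltW m0)// invfM mulrA [leLHS]mulrC; apply: ler_wpM2l.
  by rewrite invr_ge0 ltW.
rewrite [leLHS](_ : _ = (2 `^ (- 2^-1) * diameter O `^ (n%:R / 2 + s)) ^+ 2).
  set a := _ * _ `^ _; have a0 : 0 <= a by rewrite mulr_ge0 ?powR_ge0.
  have aM : a <= Num.max 1 a by rewrite le_max lexx orbT.
  by rewrite ler_sqr ?nnegrE// (le_trans a0).
rewrite exprMn !powR_sqr mulNr mulVf// powR_inv1// mulrC; congr (_ * _ `^ _).
by field.
Qed.

Lemma L2norm_sqr_le_SSseminorm s O w : 0 < s -> measurable O -> bounded_set O ->
  isL2 O w -> (\int[mu]_(x in O) (w x)%:E = 0)%E ->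
  (L2norm O w ^+ 2 <= (C_PF_SS s O ^+ 2)%:E * SSseminorm s O w ^+ 2)%E.
Proof.
move=> s0 mO bO Lw w0.
have Ooo := bounded_lebesgue_cV_lty mO bO.
have [m m0 Om] : exists2 m : R, 0 <= m & mu O = m%:E.
  by exists (fine (mu O)); rewrite ?fine_ge0// fineK// ge0_fin_numE.
have [N N0 wN] := isL2_L2norm_fin Lw.
have SS0 : (0 <= SSseminorm s O w ^+ 2)%E by rewrite expe_ge0 ?sqrte_ge0.
(* On a null set the [L^2]-norm vanishes; otherwise division by [m] is possible. *)
have [m00|mn0] := eqVneq m 0.
  have Om0 : mu O = 0%E by rewrite Om m00.
  rewrite L2norm_sqr null_set_integral//; first by rewrite mule_ge0// lee_fin sqr_ge0.
  have [mw _] := Lw.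
  apply/measurable_EFinP; apply: measurable_funX; exact: measurableT_comp.
have {}m0 : 0 < m by rewrite lt_neqAle eq_sym mn0.
set p := n%:R + 2 * s; set D := diameter O.
have p0 : 0 < p by rewrite /p ltr_wpDl// mulr_gt0.
have kern x y : O x -> O y ->
    ((`|w x - w y| ^+ 2)%:E <= (D `^ p)%:E * SSkernel s w x y)%E.
  move=> Ox Oy; rewrite /SSkernel -/p -EFinM lee_fin.
  have [->|xy] := eqVneq x y; first by rewrite subrr normr0 expr0n mul0r mulr0.
  have xy0 : 0 < enorm (x - y).
    by rewrite lt_neqAle eq_sym enorm_eq0 subr_eq0 xy enorm_ge0.
  rewrite mulrCA ler_peMr ?sqr_ge0// ler_pdivlMr ?powR_gt0// mul1r.
  have xyD : enorm (x - y) <= D by exact: bounded_diameter.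
  have D0 := le_trans (ltW xy0) xyD.
  by apply: ge0_ler_powR; rewrite ?nnegrE ?(ltW p0) ?enorm_ge0.
(* [2 m N] is the double integral of [|w x - w y|^2]: the inner integral is [N + m |w y|^2], and
   each term integrates to [m N]. *)
have key : ((2 * m * N)%:E <= (D `^ p)%:E * SSseminorm s O w ^+ 2)%E.
  rewrite [X in (_ <= _ * X)%E](SSseminorm_sqr s O w).
  have -> : ((2 * m * N)%:E =
      \int[mu]_(y in O) \int[mu]_(x in O) (`|w x - w y| ^+ 2)%:E)%E.
    under eq_integral do rewrite (integral_sqr_subr _ mO Om Lw wN w0) EFinD EFinM.
    have [mw _] := Lw.
    have mw2 : measurable_fun O (fun x => (w x ^+ 2)%:E).
      by apply/measurable_EFinP; exact: measurable_funX.
    rewrite ge0_integralD//; last 2 first.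
    - by move=> y _; rewrite mule_ge0 ?lee_fin ?sqr_ge0 ?ltW.
    - exact: measurable_funeM.
    rewrite ge0_integralZl_EFin ?ltW//; last by move=> y _; rewrite lee_fin sqr_ge0.
    rewrite integral_cst// [X in (_ * X + _)%E]Om.
    rewrite [X in (_ + _ * X)%E](_ : _ = N%:E).
      by rewrite -!EFinM -EFinD; congr EFin; ring.
    rewrite -wN L2norm_sqr; apply: eq_integral => x _.
    by rewrite real_normK ?num_real.
  apply: le_trans (ge0_lower_integralZl_le _ (powR_ge0 _ _) _); last first.
    by move=> y _; apply: integral_ge0 => x _; exact: SSkernel_ge0.
  apply: ge0_le_lower_integral => y Oy.
    by apply: integral_ge0 => x _; rewrite lee_fin sqr_ge0.
  apply: le_trans (ge0_lower_integralZl_le _ (powR_ge0 _ _) _); last first.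
    by move=> x _; exact: SSkernel_ge0.
  apply: ge0_le_lower_integral => x Ox; first by rewrite lee_fin sqr_ge0.
  exact: kern.
have m2 : 0 < 2 * m by rewrite mulr_gt0.
rewrite wN; apply: (@le_trans _ _ ((D `^ p / (2 * m))%:E * SSseminorm s O w ^+ 2)%E).
  rewrite mulrC EFinM -muleA -lee_pdivrMl ?invr_gt0// invrK -EFinM.
  exact: key.
by apply: lee_wpmul2r => //; rewrite lee_fin; exact: C_PF_SS_sqr_ge.
Qed.

Lemma interp_seminorm_sqr_le_norm s O w :
  (interp_seminorm s O w ^+ 2 <= interp_norm s O w ^+ 2)%E.
Proof.
rewrite [leLHS](interp_seminorm_sqr s O w) [leRHS](interp_norm_sqr s O w).
apply: ge0_le_lower_integral => t /=; rewrite in_itv/= andbT => t0.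
  by rewrite !mule_ge0 ?Kseminorm_ge0// lee_fin ?powR_ge0// invr_ge0 ltW.
apply: lee_wpmul2r; first by rewrite lee_fin invr_ge0 ltW.
apply: lee_wpmul2l; first by rewrite lee_fin powR_ge0.
apply: le_ereal_inf_tmp => _ [v0 [v1 [g [Lv0 Hv1 wE ->]]]].
apply: (@le_trans _ _ (L2norm O v0 ^+ 2 + (t ^+ 2)%:E * H1seminorm O g ^+ 2)%E).
  by apply: ereal_inf_lbound; exists v0, v1, g.
apply: leeD => //; apply: lee_wpmul2l; first by rewrite lee_fin sqr_ge0.
rewrite H1norm_sqr leeDr// expe_ge0 ?L2norm_ge0//.
Qed.

Lemma SSnorm_sqr s O w :
  (SSnorm s O w ^+ 2 = L2norm O w ^+ 2 + SSseminorm s O w ^+ 2)%E.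
Proof. by rewrite [LHS]sqr_sqrte// adde_ge0 ?expe_ge0 ?sqrte_ge0. Qed.

Lemma isHsP s O w : isHs s O w <->
  isL2 O w /\ (SSseminorm s O w ^+ 2 < +oo)%E.
Proof.
rewrite /isHs /SSnorm sqrte_lty; split => -[Lw SSoo]; split => //.
  apply: le_lt_trans SSoo; rewrite leeDr// expe_ge0 ?sqrte_ge0//.
have [N _ wN] := isL2_L2norm_fin Lw.
by apply: lte_add_pinfty => //; rewrite wN ltry.
Qed.

Lemma exists_mean_zero O v : measurable O -> (mu O < +oo)%E -> isL2 O v ->
  exists c : R, (\int[mu]_(x in O) (v x + c)%:E = 0)%E.
Proof.
move=> mO Ooo Lv.
have [m m0 Om] : exists2 m : R, 0 <= m & mu O = m%:E.
  by exists (fine (mu O)); rewrite ?fine_ge0// fineK// ge0_fin_numE.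
have iv := isL2_integrable mO Ooo Lv.
have ic (a : R) : mu.-integrable O (EFin \o cst a).
  by apply: isL2_integrable => //; exact: isL2_cst.
have [m00|mn0] := eqVneq m 0.
  have Om0 : mu O = 0%E by rewrite Om m00.
  exists 0; under eq_integral do rewrite addr0.
  by rewrite null_set_integral//; exact: measurable_int iv.
exists (- (fine (\int[mu]_(x in O) (v x)%:E) / m)).
under eq_integral do rewrite EFinD.
rewrite integralD//; last exact: ic.
have /fineK <- := integrable_fin_num mO iv.
rewrite integral_cst// [X in (_ + _ * X)%E]Om -EFinM -EFinD; congr EFin.
by rewrite mulNr divfK// subrr.
Qed.

End poincare.

(** * Equivalence of the seminorms on the reference domain *)

Lemma sqr_muleEFin (R : realType) (a : R) (x : \bar R) :
  ((a%:E * x) ^+ 2 = (a ^+ 2)%:E * x ^+ 2)%E.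
Proof. by rewrite !expe2 muleACA -EFinM -expr2. Qed.

Section reference_domain.
Context {R : realType} {n : nat}.
Implicit Types (O : set 'cV[R]_n) (v w : 'cV[R]_n -> R) (s : R).
Local Notation mu := (@lebesgue_cV R n).

Lemma isHs_addr_cst s O v (a : R) : measurable O -> (mu O < +oo)%E ->
  isHs s O v -> isHs s O (fun x => v x + a).
Proof.
move=> mO Ooo /isHsP[Lv Sv]; apply/isHsP; rewrite SSseminorm_addr_cst; split => //.
by apply: isL2D => //; exact: isL2_cst.
Qed.

(** For the mean-zero shift [w], norm equivalence gives [K^2], [interp_norm_sqr_le] brings in [3]
    and [1 / (s (1 - s))], and the Poincare hypothesis, its mean term being zero, turns the [L^2]
    part into [C^2] times the squared seminorm. *)
Lemma SSseminorm_le_interp s O v (K C : R) : 0 < s -> s < 1 -> 0 < K -> 0 < C ->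
  measurable O -> (mu O < +oo)%E ->
  (forall w, isHs s O w -> (SSnorm s O w <= K%:E * interp_norm s O w)%E) ->
  (forall w, isHs s O w -> (L2norm O w <= C%:E *
    (interp_seminorm s O w + `|\int[mu]_(x in O) (w x)%:E|))%E) ->
  isHs s O v ->
  (SSseminorm s O v ^+ 2 <= (K ^+ 2 * (3 + C ^+ 2 / (s * (1 - s))))%:E *
    interp_seminorm s O v ^+ 2)%E.
Proof.
move=> s0 s1 K0 C0 mO Ooo HK HC Hv; have [Lv _] := Hv.
have [a w0] := exists_mean_zero mO Ooo Lv.
set w := fun x => v x + a in w0.
have Hw : isHs s O w by exact: isHs_addr_cst.
rewrite -(SSseminorm_addr_cst s O v a) -(interp_seminorm_addr_cst s v a mO Ooo) -/w.
have In0 : (0 <= interp_norm s O w)%E by exact: sqrte_ge0.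
have Is0 : (0 <= interp_seminorm s O w)%E by exact: sqrte_ge0.
have L2le : (L2norm O w ^+ 2 <= (C ^+ 2)%:E * interp_seminorm s O w ^+ 2)%E.
  rewrite -sqr_muleEFin lee_sqr ?mule_ge0 ?L2norm_ge0 ?lee_fin ?(ltW C0)//.
  by have := HC w Hw; rewrite w0 abse0 adde0.
apply: (@le_trans _ _ (SSnorm s O w ^+ 2)%E).
  by rewrite SSnorm_sqr leeDr// expe_ge0 ?L2norm_ge0.
apply: (@le_trans _ _ ((K ^+ 2)%:E * interp_norm s O w ^+ 2)%E).
  rewrite -sqr_muleEFin lee_sqr ?mule_ge0 ?sqrte_ge0 ?lee_fin ?(ltW K0)//.
  exact: HK.
rewrite [(K ^+ 2 * _)%:E]EFinM -[leRHS]muleA; apply: lee_wpmul2l.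
  by rewrite lee_fin sqr_ge0.
have s1' : 0 <= (s * (1 - s))^-1 by rewrite invr_ge0 mulr_ge0 ?ltW// subr_gt0.
apply: le_trans (interp_norm_sqr_le s0 s1 mO Ooo (Hw.1)) _.
rewrite [(3 + C ^+ 2 / _)%:E]EFinD [leRHS]ge0_muleDl ?lee_fin ?(mulr_ge0 (sqr_ge0 C))//.
apply: leeD => //; rewrite (mulrC (C ^+ 2)) EFinM -[leRHS]muleA.
by apply: lee_wpmul2l => //; rewrite lee_fin.
Qed.

(** For the mean-zero shift [w], the seminorm is below the norm and norm equivalence gives [k^-2].
    In the squared Slobodeckij norm the seminorm accounts for the [1] and the [L^2] part for
    [C_PF_SS s O ^+ 2]. *)
Lemma interp_le_SSseminorm s O v (k : R) : 0 < s -> 0 < k ->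
  measurable O -> bounded_set O ->
  (forall w, isHs s O w -> (k%:E * interp_norm s O w <= SSnorm s O w)%E) ->
  isHs s O v ->
  (interp_seminorm s O v ^+ 2 <= (k ^- 2 * (1 + C_PF_SS s O ^+ 2))%:E *
    SSseminorm s O v ^+ 2)%E.
Proof.
move=> s0 k0 mO bO Hk Hv; have [Lv _] := Hv.
have Ooo := bounded_lebesgue_cV_lty mO bO.
have [a w0] := exists_mean_zero mO Ooo Lv.
set w := fun x => v x + a in w0.
have Hw : isHs s O w by exact: isHs_addr_cst.
rewrite -(SSseminorm_addr_cst s O v a) -(interp_seminorm_addr_cst s v a mO Ooo) -/w.
apply: le_trans (interp_seminorm_sqr_le_norm s O w) _.
rewrite EFinM -muleA lee_pdivlMl ?exprn_gt0//.
apply: (@le_trans _ _ (SSnorm s O w ^+ 2)%E).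
  rewrite -sqr_muleEFin lee_sqr ?mule_ge0 ?sqrte_ge0 ?lee_fin ?(ltW k0)//.
  exact: Hk.
rewrite SSnorm_sqr EFinD ge0_muleDl ?lee_fin ?sqr_ge0// mul1e addeC.
apply: leeD => //; apply: L2norm_sqr_le_SSseminorm => //; exact: Hw.1.
Qed.

End reference_domain.

Theorem theorem3p1 (R : realType) (n : nat) (n_gt0 : (0 < n)%N)
    (Oh : set 'cV[R]_n) (Oh_dom : bounded_lipschitz_domain Oh)
    (x0 : 'cV[R]_n) (B : 'M[R]_n) (B_inv : B \in unitmx)
    (s : R) (s_gt0 : 0 < s) (s_lt1 : s < 1)
    (k K C_PF_I : R) (k_gt0 : 0 < k) (K_gt0 : 0 < K) (C_PF_I_gt0 : 0 < C_PF_I)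
    (norm_equiv : forall w : 'cV[R]_n -> R, isHs s Oh w ->
      (k%:E * interp_norm s Oh w <= SSnorm s Oh w)%E /\
      (SSnorm s Oh w <= K%:E * interp_norm s Oh w)%E)
    (PF_I : forall w : 'cV[R]_n -> R, isHs s Oh w ->
      (L2norm Oh w <= C_PF_I%:E *
        (interp_seminorm s Oh w + `|\int[lebesgue_cV]_(x in Oh) (w x)%:E|))%E) :
  let O := [set x0 + B *m x | x in Oh] in
  forall v : 'cV[R]_n -> R, isHs s O v ->
    (SSseminorm s O v ^+ 2 <=
      (`|\det B| * opnorm (invmx B) `^ (n%:R + 2 * s) * opnorm B `^ (2 * s) *
       K ^+ 2 * (3 + C_PF_I ^+ 2 / (s * (1 - s))))%:E *
      interp_seminorm s O v ^+ 2)%E /\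
    (interp_seminorm s O v ^+ 2 <=
      (`|\det B|^-1 * opnorm B `^ (n%:R + 2 * s) * opnorm (invmx B) `^ (2 * s) *
       k ^- 2 * (1 + C_PF_SS s Oh ^+ 2))%:E *
      SSseminorm s O v ^+ 2)%E.
Proof.
move=> O v Hv.
have [_ oOh _ bOh _] := Oh_dom.
have mOh := open_measurable_cV oOh.
have Ohoo := bounded_lebesgue_cV_lty mOh bOh.
have uBV : invmx B \in unitmx by rewrite unitmx_inv.
have d0 := normr_det_gt0 B_inv; have dn0 := gt_eqF d0.
pose F := affine_map x0 B; pose G := affine_map (- invmx B *m x0) (invmx B).
(* Viewing [Oh] as the image of [O] under the inverse map makes the one-sided transfer lemmas
   available in the other direction. *)
have GO : G @` O = Oh.
  rewrite [LHS](image_comp F G) (_ : G \o F = id) ?image_id//.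
  by apply/funext => x; rewrite /G /F /= affine_mapK.
have mO : measurable O by exact: (measurable_image_affine_map x0 B_inv mOh).
have Ooo : (lebesgue_cV O < +oo)%E.
  have := ge0_integral_affine_map (A := Oh) (f := cst 1%E) (c := x0) B_inv
    (fun _ _ => lee01).
  rewrite -/O !integral_cst// ?mul1e => ->.
  by apply: lte_mul_pinfty.
pose vh := v \o F.
have vhG : vh \o G = v by apply/funext => x; rewrite /vh /F /G /= affine_mapVK.
have [Lv Sv] := (isHsP s O v).1 Hv.
(* Transfer along [G]; it shows that [vh] belongs to [H^s] on [Oh], and it is also the last link in
   the chain for (ii). *)
have SSh : (SSseminorm s Oh vh ^+ 2 <=
    (`|\det B| ^- 2 * opnorm B `^ (n%:R + 2 * s))%:E * SSseminorm s O v ^+ 2)%E.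
  have := SSseminorm_affine_map_le (- invmx B *m x0) O vh s_gt0 uBV.
  by rewrite -/G GO vhG normr_det_inv invmxK exprVn.
have Hvh : isHs s Oh vh.
  apply/isHsP; split; first exact: (isL2_affine_map mOh B_inv Lv).
  apply: le_lt_trans SSh _; apply: lte_mul_pinfty => //.
  by rewrite lee_fin mulr_ge0 ?invr_ge0 ?sqr_ge0 ?powR_ge0.
split.
  apply: le_trans (SSseminorm_affine_map_le x0 Oh v s_gt0 B_inv) _.
  have c0 : 0 <= `|\det B| ^+ 2 * opnorm (invmx B) `^ (n%:R + 2 * s).
    by rewrite mulr_ge0 ?sqr_ge0 ?powR_ge0.
  have c1 : 0 <= 3 + C_PF_I ^+ 2 / (s * (1 - s)).
    by rewrite addr_ge0// mulr_ge0 ?sqr_ge0// invr_ge0 mulr_ge0 ?ltW// subr_gt0.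
  apply: le_trans (lee_wpmul2l _ (SSseminorm_le_interp s_gt0 s_lt1 K_gt0
    C_PF_I_gt0 mOh Ohoo (fun w Hw => (norm_equiv w Hw).2) PF_I Hvh)) _.
    by rewrite lee_fin.
  rewrite muleA -EFinM.
  have I1 := interp_seminorm_affine_map_le s x0 v n_gt0 mOh Ohoo B_inv.
  apply: le_trans (lee_wpmul2l _ I1) _.
    by rewrite lee_fin (mulr_ge0 c0)// (mulr_ge0 (sqr_ge0 K)).
  rewrite muleA -EFinM le_eqVlt; apply/orP; left; apply/eqP.
  congr ((_)%:E * _)%E.
  (* The double integral gives [d^2] and the K-functional [d^-1], leaving one factor [d]. *)
  have alg (d p q a c : R) : d != 0 ->
      d ^+ 2 * p * (a * c) * (d^-1 * q) = d * p * q * a * c by move=> ?; field.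
  by apply: alg; rewrite dn0.
(* For (ii) the interpolation seminorm is transferred along [G], with factor [|det B| |B^-1|^(2s)];
   together with the [|det B|^-2] of [SSh] this leaves [|det B|^-1]. *)
have I1 := interp_seminorm_affine_map_le s (- invmx B *m x0) vh n_gt0 mO Ooo uBV.
rewrite -/G GO vhG normr_det_inv invrK in I1.
apply: le_trans I1 _.
have c0 : 0 <= `|\det B| * opnorm (invmx B) `^ (2 * s).
  by rewrite mulr_ge0 ?powR_ge0.
apply: le_trans (lee_wpmul2l _ (interp_le_SSseminorm s_gt0 k_gt0 mOh bOh
  (fun w Hw => (norm_equiv w Hw).1) Hvh)) _; first by rewrite lee_fin.
rewrite muleA -EFinM; apply: le_trans (lee_wpmul2l _ SSh) _.
  rewrite lee_fin (mulr_ge0 c0)// mulr_ge0 ?invr_ge0 ?sqr_ge0//.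
  by rewrite addr_ge0// sqr_ge0.
rewrite muleA -EFinM le_eqVlt; apply/orP; left; apply/eqP.
congr ((_)%:E * _)%E.
have alg (d p q a c : R) : d != 0 ->
    d * p * (a * c) * (d ^- 2 * q) = d^-1 * q * p * a * c by move=> ?; field.
by apply: alg; rewrite dn0.
Qed.
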